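(* Let $D$ be a prime. Consider a three-colorable $\{p,3\}$-lattice with vertex set $V$, $|V|=n$, and edge set $E=E_g\sqcup E_r\sqcup E_b$ on a closed orientable surface of genus $\mathfrak{g}\ge1$, where $p=6$ if $\mathfrak{g}=1$ and $p\ge8$ is even if $\mathfrak{g}\ge2$. For every vertex $v\in V$ and color $l\in\{g,r,b\}$ let $P_{v_l}=X^{a}Z^{b}$ (with $(a,b)=v_l\in[D]\times[D]$) be a phaseless qudit Pauli, and let the checks be $C_l=\{M_{(v,u)}=[P_{v_l}]_v[P_{u_l}]_u:(v,u)\in E_l\}$. Suppose: 1. $c(P_{v_g},P_{v_b})=-c(P_{u_g},P_{u_b})$ for all $(v,u)\in E_g$; $c(P_{v_r},P_{v_g})=-c(P_{u_r},P_{u_g})$ for all $(v,u)\in E_r$; and $c(P_{v_b},P_{v_r})=-c(P_{u_b},P_{u_r})$ for all $(v,u)\in E_b$. 2. For every $v\in V$: $c(P_{v_g},P_{v_r})\ne0$, $c(P_{v_r},P_{v_b})\neq0$, and $c(P_{v_b},P_{v_g})\ne0$. 3. For every $(v,u)\in E$: $[P_{v_g}P_{v_r}P_{v_b}]_v\,[P_{u_g}P_{u_r}P_{u_b}]_u=I^{\otimes n}$. Then the $n$-qudit Floquet code defined by these checks encodes $k=2\mathfrak{g}$ logical qudits; that is, there is a finite $T$ such that for all rounds $t\ge T$ the instantaneous stabilizer group $\mathcal{S}_t$ satisfies $\dim\mathcal{C}(\mathcal{S}_t)=D^{2\mathfrak{g}}$.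
   Context: Paulis: $\omega=e^{2\pi i/D}$, $[D]=\{0,\dots,D-1\}$, arithmetic mod $D$; $X=\sum_j|j+1\bmod D\rangle\langle j|$, $Z=\sum_j\omega^j|j\rangle\langle j|$ on $\mathbb{C}^D$; $P_{a,b}=X^aZ^b$; $\mathcal{P}_D=\{\omega^lP_{a,b}:a,b,l\in[D]\}$. The commutation function is $c(P_{a,b},P_{a',b'})=-ab'+ba'\in\mathbb{Z}/D$, so that $P_{a,b}P_{a',b'}=\omega^{c(P_{a,b},P_{a',b'})}P_{a',b'}P_{a,b}$. For $P\in\mathcal{P}_D$ and $v\in V$, $[P]_v$ denotes the $n$-qudit operator acting as $P$ on the qudit $v$ and as the identity on all other qudits. Lattice: one qudit of dimension $D$ sits on each vertex. A $\{p,3\}$-lattice on a closed orientable surface is a tessellation (cellular embedding of a connected simple graph $(V,E)$) in which every face (''plaquette'') has $p$ edges and every vertex has degree $3$. Three-colorable means that the faces can be colored green ($g$), red ($r$), blue ($b$) so that faces sharing an edge have different colors; fix such a coloring. An edge gets color $l$ if the two faces it connects (those at its two endpoints and not containing the edge in their boundary) have color $l$; thus each vertex meets exactly one edge of each color. $E_l$ is the set of color-$l$ edges. Stabilizer groups: a stabilizer group $\mathcal{S}$ is an abelian subgroup of $\mathcal{P}_D^{\otimes n}$ without nontrivial scalars, and $\mathcal{C}(\mathcal{S})$ is the common $+1$ eigenspace of $\mathcal{S}$; it encodes $k$ logical qudits if $\dim\mathcal{C}(\mathcal{S})=D^k$. Measurement update: measuring an $n$-qudit Pauli $P$ (with $P^D=I$,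 automatic for odd $D$; for $D=2$ all checks are assumed to satisfy this) with outcome $o\in[D]$ means projecting onto the $\omega^o$-eigenspace of $P$. It updates $\mathcal{S}$ to the group $\mathcal{S}'$ generated by $\omega^{-o}P$ and all elements of $\mathcal{S}$ commuting with $P$ (where $o$ is an outcome of nonzero probability on $\mathcal{C}(\mathcal{S})$). Floquet code: start at round $t=-1$ with $\mathcal{S}_{-1}=\{I^{\otimes n}\}$. In round $t\ge0$ measure all checks in $C_g$ if $t\equiv0$, in $C_r$ if $t\equiv1$, in $C_b$ if $t\equiv2\pmod 3$. The instantaneous stabilizer group $\mathcal{S}_t$ is obtained from $\mathcal{S}_{t-1}$ by applying the update for each of these (mutually commuting) measurements, for any outcomes of nonzero probability. The Floquet code encodes $k$ logical qudits if, after a finite number $T$ of initialization rounds, $\mathcal{C}(\mathcal{S}_t)$ encodes $k$ logical qudits for all $t\ge T$ (regardless of the outcomes). *)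

(* Defs.v *)
From HB Require Import structures.
From mathcomp Require Import all_boot all_order all_algebra perm.
From mathcomp Require Import complex.
From mathcomp Require Import classical_sets reals trigo.

Set Implicit Arguments.
Unset Strict Implicit.
Unset Printing Implicit Defensive.

Import Order.TTheory GRing.Theory Num.Theory.
Local Open Scope ring_scope.

Inductive color := green | red | blue.

(* A cellular embedding of a connected simple graph in a closed orientable
   surface is given, up to orientation-preserving homeomorphism, by a rotation
   system: [rot v] is the cyclic order, for the orientation of the surface, of
   the neighbours of [v], as a permutation fixing all other vertices. *)
Record embedded_graph (V : finType) := EmbeddedGraph {
  adj : rel V;
  rot : V -> {perm V};
  adj_sym : symmetric adj;
  adj_irr : irreflexive adj;
  adj_nonempty : (0 < #|V|)%N;
  adj_connected : forall v u, connect adj v u;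
  rot_on : forall v, perm_on [set u | adj v u] (rot v);
  rot_cyclic : forall v u w, adj v u -> adj v w -> w \in porbit (rot v) u
}.

Definition edges (V : finType) (L : embedded_graph V) : {set {set V}} :=
  [set [set d.1; d.2] | d in [set d : V * V | adj L d.1 d.2]].

(* Face tracing: the directed edge following (v, u) on the boundary of the
   face lying on a fixed side of (v, u). *)
Definition face_next (V : finType) (L : embedded_graph V) (d : V * V) : V * V :=
  (d.2, rot L d.2 d.1).

(* A face is represented by the set of directed edges of its boundary walk;
   each edge has two directed versions, one for each of its sides. *)
Definition face (V : finType) (L : embedded_graph V) (d : V * V) :
    {set V * V} :=
  [set d' | fconnect (face_next L) d d'].

Definition faces (V : finType) (L : embedded_graph V) : {set {set V * V}} :=
  [set face L d | d in [set d : V * V | adj L d.1 d.2]].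

(* Euler's formula |V| - |E| + |F| = 2 - 2 g. *)
Definition has_genus (V : finType) (L : embedded_graph V) (g : nat) : Prop :=
  #|V|%:Z - #|edges L|%:Z + #|faces L|%:Z = 2 - 2 * g%:Z.

Definition p3_lattice (V : finType) (L : embedded_graph V) (p : nat) : Prop :=
  (forall f, f \in faces L -> #|f| = p) /\
  (forall v, #|[set u | adj L v u]| = 3%N).

Definition three_coloring (V : finType) (L : embedded_graph V)
    (col : {set V * V} -> color) : Prop :=
  forall v u, adj L v u -> col (face L (v, u)) <> col (face L (u, v)).

Definition face_at (V : finType) (f : {set V * V}) (v : V) : Prop :=
  exists w, (v, w) \in f.

Definition face_has_edge (V : finType) (f : {set V * V}) (v u : V) : Prop :=
  (v, u) \in f \/ (u, v) \in f.

Definition edge_color (V : finType) (L : embedded_graph V)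
    (col : {set V * V} -> color) (l : color) (v u : V) : Prop :=
  adj L v u /\
  forall f, f \in faces L -> face_at f v \/ face_at f u ->
    ~ face_has_edge f v u -> col f = l.

Definition omega (R : realType) (D : nat) : R[i] :=
  Complex (cos (2 * pi / D%:R)) (sin (2 * pi / D%:R)).

Definition pauliX (R : realType) (D : nat) : 'M[R[i]]_D :=
  \matrix_(i, j) (i == ordS j)%:R.

Definition pauliZ (R : realType) (D : nat) : 'M[R[i]]_D :=
  diag_mx (\row_j omega R D ^+ j).

Definition pauli (R : realType) (D : nat) (x : 'I_D * 'I_D) : 'M[R[i]]_D :=
  pauliX R D ^+ x.1 * pauliZ R D ^+ x.2.

(* 'F_D is Z/D for D prime. *)
Definition comm (D : nat) (x y : 'I_D * 'I_D) : 'F_D :=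
  - (x.1%:R * y.2%:R) + x.2%:R * y.1%:R.

(* Operators on (states of) the qudits sitting on V are matrices (column
   vectors) indexed, through [enum_val], by the basis states V -> 'I_D. *)
Notation op R D V := 'M[R[i]]_#|{: {ffun V -> 'I_D}}|.
Notation state R D V := 'cV[R[i]]_#|{: {ffun V -> 'I_D}}|.

Definition tensor (R : realType) (D : nat) (V : finType)
    (A : V -> 'M[R[i]]_D) : op R D V :=
  \matrix_(i, j) \prod_(v : V)
    A v ((enum_val i : {ffun V -> 'I_D}) v) ((enum_val j : {ffun V -> 'I_D}) v).

Definition on_site (R : realType) (D : nat) (V : finType) (v : V)
    (A : 'M[R[i]]_D) : op R D V :=
  tensor (fun w => if w == v then A else 1).

Definition inner (R : realType) (n : nat) (x y : 'cV[R[i]]_n) : R[i] :=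
  \sum_i (x i 0)^* * y i 0.

Definition is_group (R : realType) (n : nat) (S : set 'M[R[i]]_n) : Prop :=
  [/\ S 1, (forall A B, S A -> S B -> S (A * B))
    & (forall A, S A -> S (invmx A))].

Definition generated (R : realType) (n : nat) (G : set 'M[R[i]]_n) :
    set 'M[R[i]]_n :=
  smallest (@is_group R n) G.

Definition codespace (R : realType) (n : nat) (S : set 'M[R[i]]_n) :
    set 'cV[R[i]]_n :=
  fun psi => forall A, S A -> A *m psi = psi.

Definition encodes (R : realType) (n D : nat) (S : set 'M[R[i]]_n) (k : nat) :
    Prop :=
  exists U : {vspace 'cV[R[i]]_n},
    (forall psi, psi \in U <-> codespace S psi) /\ (\dim U = D ^ k)%N.

(* phi is the orthogonal projection of psi on the eigenspace of P for
   omega ^ o. *)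
Definition outcome_projection (R : realType) (n D : nat) (P : 'M[R[i]]_n)
    (o : 'I_D) (psi phi : 'cV[R[i]]_n) : Prop :=
  P *m phi = omega R D ^+ o *: phi /\
  forall chi, P *m chi = omega R D ^+ o *: chi -> inner chi (psi - phi) = 0.

(* By the Born rule, the outcome o has nonzero probability in the state psi
   iff the projection of psi does not vanish. *)
Definition possible_outcome (R : realType) (n D : nat) (S : set 'M[R[i]]_n)
    (P : 'M[R[i]]_n) (o : 'I_D) : Prop :=
  exists psi phi,
    [/\ codespace S psi, outcome_projection P o psi phi & phi != 0].

Definition update (R : realType) (n D : nat) (S : set 'M[R[i]]_n)
    (P : 'M[R[i]]_n) (o : 'I_D) : set 'M[R[i]]_n :=
  generated (fun A => A = omega R D ^- o *: P \/ (S A /\ A * P = P * A)).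

Fixpoint measure_seq (R : realType) (n D : nat) (S : set 'M[R[i]]_n)
    (s : seq 'M[R[i]]_n) (S' : set 'M[R[i]]_n) : Prop :=
  if s is P :: s' then
    exists o : 'I_D, possible_outcome S P o /\
      measure_seq D (update S P o) s' S'
  else S' = S.

(* The operators in C are measured once each, in an arbitrary order. *)
Definition measure_round (R : realType) (n D : nat) (C S S' : set 'M[R[i]]_n) :
    Prop :=
  exists s : seq 'M[R[i]]_n,
    [/\ uniq s, (forall M, M \in s <-> C M) & measure_seq D S s S'].

Definition round_color (t : nat) : color :=
  match (t %% 3)%N with 0%N => green | 1%N => red | _ => blue end.

(* S t is the instantaneous stabilizer group after round t; before round 0 it
   is the trivial group. *)
Definition isg_run (R : realType) (n D : nat) (C : color -> set 'M[R[i]]_n)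
    (S : nat -> set 'M[R[i]]_n) : Prop :=
  measure_round D (C green) (fun A => A = 1) (S 0%N) /\
  forall t, measure_round D (C (round_color t.+1)) (S t) (S t.+1).

Definition floquet_encodes (R : realType) (n D : nat)
    (C : color -> set 'M[R[i]]_n) (k : nat) : Prop :=
  exists T : nat, forall S, isg_run D C S ->
    forall t, (T <= t)%N -> encodes D (S t) k.

Definition check (R : realType) (D : nat) (V : finType)
    (lab : color -> V -> 'I_D * 'I_D) (l : color) (v u : V) : op R D V :=
  on_site v (pauli R (lab l v)) * on_site u (pauli R (lab l u)).

Definition checks (R : realType) (D : nat) (V : finType)
    (L : embedded_graph V) (col : {set V * V} -> color)
    (lab : color -> V -> 'I_D * 'I_D) (l : color) : set (op R D V) :=
  fun M => exists v u, edge_color L col l v u /\ M = check R lab l v u.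

(* Main.v *)
(* Forgetting phases, an n-qudit Pauli is a label in F_D^(2n), and a stabilizer
   group with a nonzero code space is determined up to phases by its set B of
   labels; the trace of the projector (1/|B|) sum_(A in S) A shows that the code
   space has dimension D^n / |B|.  Measuring a Pauli of label m replaces B by
   (B meet the symplectic complement of m) + <m>, and a possible outcome keeps
   the code space nonzero.

   Condition 3 says that the three labels at each vertex sum to zero, so their
   symplectic products in cyclic order are one number kappa(v) <> 0, which by
   condition 1 changes sign along every edge.  Write s_c for the involution
   exchanging the ends of the edges of color c.  A product of checks of color l
   commuting with the checks of the next color has exponents constant around the
   plaquettes of the third color, so, modulo the new checks, it is a product of
   plaquettes.  Hence from round 3 on, B is generated by the checks of the round
   and all the plaquettes.  There are n/2 + |F| generators and, by
   connectedness, a two-dimensional space of relations, so |B| = D^(n/2 + |F| - 2) = D^(n - 2g)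
   by Euler's formula. *)

From HB Require Import structures.
Require Import Defs.
From mathcomp Require Import all_boot all_order all_algebra perm.
From mathcomp Require Import complex.
From mathcomp Require Import boolp classical_sets reals trigo.
From mathcomp Require Import ring zify.

Set Implicit Arguments.
Unset Strict Implicit.
Unset Printing Implicit Defensive.

Import Order.TTheory GRing.Theory Num.Theory.
Local Open Scope ring_scope.

(** * Qudit Pauli operators *)

Lemma scale_mulmxl (C : comPzRingType) n (a : C) (A B : 'M[C]_n) :
  (a *: A) * B = a *: (A * B).
Proof. exact/esym/scalemxAl. Qed.

Lemma scale_mulmxr (C : comPzRingType) n (a : C) (A B : 'M[C]_n) :
  A * (a *: B) = a *: (A * B).
Proof. exact/esym/scalemxAr. Qed.

Section Omega.
Variables (R : realType) (D : nat).
Hypothesis D_gt1 : (1 < D)%N.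
Local Notation w := (omega R D).

Lemma omega_expE n :
  w ^+ n = Complex (cos ((2 * pi / D%:R) *+ n)) (sin ((2 * pi / D%:R) *+ n)).
Proof.
elim: n => [|n IHn]; first by rewrite expr0 mulr0n cos0 sin0.
rewrite exprS IHn; set t := _ / _; rewrite (mulrS t) cosD sinD.
apply/eqP; rewrite eq_complex /=.
by apply/andP; split; apply/eqP; ring.
Qed.

Lemma omega_expD : w ^+ D = 1.
Proof.
rewrite omega_expE -mulr_natr divfK ?pnatr_eq0 -?lt0n ?(ltnW D_gt1) //.
by rewrite mulr_natl cos2pi sin2pi.
Qed.

Lemma omega_neq1 : w != 1.
Proof.
rewrite /omega eq_complex /= negb_and; apply/orP; left.
apply/eqP => cosE.
have D0 : 0 < D%:R :> R by rewrite ltr0n (ltnW D_gt1).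
have pi0 := pi_gt0 R.
(* For [1 < D] the angle lies in [0, pi], where the cosine is injective. *)
have : 2 * pi / D%:R = 0 :> R.
  apply: cos_inj; rewrite ?cos0 // in_itv /= ?lexx ?(ltW pi0) //.
  rewrite divr_ge0 ?mulr_ge0 ?(ltW pi0) ?(ltW D0) //= ler_pdivrMr // mulrC.
  by rewrite ler_pM2l // ler_nat.
by move/eqP; rewrite !mulf_eq0 invr_eq0 (gt_eqF D0) (gt_eqF pi0) pnatr_eq0.
Qed.

Lemma omega_neq0 : w != 0.
Proof.
apply: contra_eq_neq omega_expD => ->.
by rewrite expr0n gtn_eqF ?(ltnW D_gt1) // eq_sym oner_eq0.
Qed.

Lemma omega_conj : w^* * w = 1.
Proof.
apply/eqP; rewrite eq_complex /=; apply/andP; split; apply/eqP; last by ring.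
by rewrite mulNr opprK -!expr2 cos2Dsin2.
Qed.

Hypothesis Dprime : prime D.

(** An additive character of Z/D, because [w ^+ D = 1]. *)
Definition chi (a : 'F_D) : R[i] := w ^+ a.

Lemma chi_nat n : chi n%:R = w ^+ n.
Proof. by rewrite /chi val_Fp_nat // expr_mod // omega_expD. Qed.

Lemma chi0 : chi 0 = 1. Proof. by rewrite /chi expr0. Qed.

Lemma chiD a b : chi (a + b) = chi a * chi b.
Proof.
by rewrite -[a in LHS]natr_Zp -[b in LHS]natr_Zp -natrD chi_nat exprD.
Qed.

Lemma chi_neq0 a : chi a != 0.
Proof. by rewrite expf_neq0 ?omega_neq0. Qed.

Lemma chi_sum (I : finType) (F : I -> 'F_D) :
  chi (\sum_i F i) = \prod_i chi (F i).
Proof. exact: (big_morph chi chiD chi0). Qed.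

(** For nonzero [a], the unit 1 is a natural multiple of [a] since D is prime, so [chi a = 1] would
    force [w = 1]. *)
Lemma chi_eq1 a : (chi a == 1) = (a == 0).
Proof.
apply/eqP/eqP => [chia|->]; last exact: chi0.
apply/eqP; apply: contraT => a0.
have : chi 1 != 1 by rewrite -[1]/(1%:R) chi_nat expr1 omega_neq1.
suff -> : chi 1 = 1 by rewrite eqxx.
have -> : 1 = a * (a^-1 : 'F_D)%:R by rewrite natr_Zp divff.
rewrite mulr_natr; elim: (nat_of_ord _) => [|n IHn].
  by rewrite mulr0n chi0.
by rewrite mulrS chiD chia IHn mulr1.
Qed.

Local Notation X := (pauliX R D).
Local Notation Z := (pauliZ R D).

Lemma pauliX_expE n i j : (X ^+ n) i j = (i == iter n (@ordS D) j)%:R.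
Proof.
elim: n i j => [|n IHn] i j; first by rewrite expr0 /= mxE.
rewrite exprSr mxE (bigD1 (ordS j)) //= IHn mxE eqxx mulr1 big1 => [|k k_neq].
  by rewrite addr0 -iterSr.
by rewrite mxE (negPf k_neq) mulr0.
Qed.

Lemma iter_ordS n (j : 'I_D) : iter n (@ordS D) j = ((j + n) %% D)%N :> nat.
Proof.
elim: n => [|n IHn] /=; first by rewrite addn0 modn_small.
by rewrite IHn -addn1 modnDml addn1 addnS.
Qed.

Lemma pauliZ_expE n : Z ^+ n = diag_mx (\row_j w ^+ (j * n)%N).
Proof.
elim: n => [|n IHn].
  apply/matrixP => i j; rewrite expr0 !mxE muln0 expr0 //.
rewrite exprS IHn -[LHS]/(_ *m _); apply/matrixP => i j.
rewrite mul_diag_mx !mxE mulnS exprD.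
by case: eqP => [->|]; rewrite ?mulr1n ?mulr0n ?mulr0.
Qed.

Lemma pauliXD : X ^+ D = 1.
Proof.
apply/matrixP => i j; rewrite pauliX_expE mxE; congr (nat_of_bool _)%:R.
congr (_ == _); apply/ord_inj/esym.
by rewrite iter_ordS modnDr modn_small.
Qed.

Lemma pauliZD : Z ^+ D = 1.
Proof.
rewrite pauliZ_expE; apply/matrixP => i j; rewrite !mxE.
by rewrite mulnC exprM omega_expD expr1n.
Qed.

Lemma pauliZX : Z * X = w *: (X * Z).
Proof.
rewrite -[LHS]/(_ *m _) -[X in _ *: X]/(_ *m _); apply/matrixP => i j.
rewrite mul_diag_mx mxE [RHS]mxE mul_mx_diag !mxE.
case: eqP => [->|_]; last by rewrite mulr0 mul0r mulr0.
by rewrite mulr1 mul1r /= expr_mod ?omega_expD // exprS.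
Qed.

Lemma pauliZXn a b : Z ^+ b * X ^+ a = w ^+ (b * a)%N *: (X ^+ a * Z ^+ b).
Proof.
have ZXa : Z * X ^+ a = w ^+ a *: (X ^+ a * Z).
  elim: a => [|a IHa]; first by rewrite !expr0 mulr1 mul1r scale1r.
  rewrite [in LHS]exprSr mulrA IHa scale_mulmxl -[_ * Z * X]mulrA pauliZX.
  by rewrite scale_mulmxr scalerA -exprSr mulrA -exprSr.
elim: b => [|b IHb]; first by rewrite mul0n !expr0 mulr1 mul1r scale1r.
rewrite [in LHS]exprS -mulrA IHb scale_mulmxr [Z * _]mulrA ZXa scale_mulmxl.
rewrite scalerA.
rewrite -[_ * Z * _]mulrA -exprS.
by rewrite -exprD addnC mulSn.
Qed.

Definition pau (x : 'F_D * 'F_D) : 'M[R[i]]_D := X ^+ x.1 * Z ^+ x.2.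

Lemma pau_nat a b : pau (a%:R, b%:R) = X ^+ a * Z ^+ b.
Proof.
by rewrite /pau /= !val_Fp_nat // !expr_mod ?pauliXD ?pauliZD.
Qed.

Lemma pauM x y : pau x * pau y = chi (x.2 * y.1) *: pau (x + y).
Proof.
rewrite {1 2}/pau mulrA -[_ * _ * X ^+ _]mulrA pauliZXn.
rewrite scale_mulmxr scale_mulmxl.
rewrite [_ * (_ * _)]mulrA -exprD -mulrA -exprD -pau_nat !natrD !natr_Zp.
by rewrite -chi_nat natrM !natr_Zp.
Qed.

Lemma pau0 : pau 0 = 1.
Proof. by rewrite /pau /= !expr0 mulr1. Qed.

Definition adj_mx n (A : 'M[R[i]]_n) : 'M[R[i]]_n := map_mx Num.conj A^T.

Lemma adj_mxM n (A B : 'M[R[i]]_n) : adj_mx (A * B) = adj_mx B * adj_mx A.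
Proof. by rewrite /adj_mx trmx_mul map_mxM. Qed.

Lemma pauliX_isometry : adj_mx X * X = 1.
Proof.
apply/matrixP => i j; rewrite !mxE (bigD1 (ordS i)) //= !mxE eqxx conjC1 mul1r.
rewrite big1 => [|k k_neq]; last by rewrite !mxE (negPf k_neq) conjC0 mul0r.
by rewrite addr0 (inj_eq (@ordS_inj D)).
Qed.

Lemma pauliZ_isometry : adj_mx Z * Z = 1.
Proof.
rewrite -[LHS]/(_ *m _); apply/matrixP => i j; rewrite mul_mx_diag !mxE.
have [->|_] := eqVneq j i; last by rewrite mulr0n conjC0 mul0r.
by rewrite mulr1n rmorphXn -exprMn omega_conj expr1n.
Qed.

Lemma isometryX n (A : 'M[R[i]]_n) k :
  adj_mx A * A = 1 -> adj_mx (A ^+ k) * A ^+ k = 1.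
Proof.
move=> isoA; elim: k => [|k IHk].
  by rewrite expr0 mulr1 /adj_mx trmx1 map_mx1.
rewrite [in adj_mx _]exprS exprS adj_mxM mulrA -(mulrA (adj_mx (_ ^+ k))).
by rewrite isoA mulr1.
Qed.

Lemma pau_isometry x : adj_mx (pau x) * pau x = 1.
Proof.
rewrite /pau adj_mxM mulrA -(mulrA (adj_mx _)) (isometryX _ pauliX_isometry).
by rewrite mulr1 (isometryX _ pauliZ_isometry).
Qed.

End Omega.

(** * Tensor products of one-site operators *)

Section Tensor.
Variables (R : realType) (D : nat) (V : finType).
Implicit Types A B : V -> 'M[R[i]]_D.

Lemma eq_tensor A B : A =1 B -> tensor A = tensor B.
Proof.
move=> eqAB; apply/matrixP => i j; rewrite !mxE.
by apply: eq_bigr => v _; rewrite eqAB.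
Qed.

Lemma tensorM A B : tensor A * tensor B = tensor (fun v => A v * B v).
Proof.
apply/matrixP => i j; rewrite !mxE.
under [RHS]eq_bigr do rewrite mxE.
(* A product over sites of sums over ['I_D] expands into a sum over functions on [V], which are the
   intermediate basis states. *)
rewrite bigA_distr_bigA /= (reindex (@enum_rank _)) /=; last first.
  by apply: onW_bij; exact: enum_rank_bij.
apply: eq_bigr => f _; rewrite !mxE enum_rankK -big_split.
by apply: eq_bigr.
Qed.

Lemma tensor1 : tensor (fun _ : V => 1 : 'M[R[i]]_D) = 1.
Proof.
apply/matrixP => i j; rewrite !mxE.
under eq_bigr do rewrite mxE.
have [->|ij] := eqVneq i j; first by rewrite big1 // => v _; rewrite eqxx.
have [v vP] : exists v, (enum_val i : {ffun V -> 'I_D}) v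
    != (enum_val j : {ffun V -> 'I_D}) v.
  apply/existsP; apply: contraNT ij; rewrite negb_exists => /forallP eqv.
  apply/eqP/enum_val_inj/ffunP => v; apply/eqP; rewrite -[_ == _]negbK.
  exact: eqv.
by rewrite (bigD1 v) //= (negPf vP) mul0r.
Qed.

Lemma tensorZ (c : V -> R[i]) A :
  tensor (fun v => c v *: A v) = (\prod_v c v) *: tensor A.
Proof.
apply/matrixP => i j; rewrite !mxE -big_split.
by apply: eq_bigr => v _; rewrite mxE.
Qed.

Lemma adj_tensor A : adj_mx (tensor A) = tensor (fun v => adj_mx (A v)).
Proof.
apply/matrixP => i j; rewrite !mxE rmorph_prod.
by apply: eq_bigr => v _; rewrite !mxE.
Qed.

End Tensor.

Section InnerProduct.
Variables (R : realType) (n : nat).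
Implicit Types x y : 'cV[R[i]]_n.

Lemma innerE x y : inner x y = (map_mx Num.conj x^T *m y) 0 0.
Proof. by rewrite mxE; apply: eq_bigr => i _; rewrite !mxE. Qed.

Lemma inner_isometry (A : 'M[R[i]]_n) x y :
  adj_mx A * A = 1 -> inner (A *m x) (A *m y) = inner x y.
Proof.
move=> isoA; rewrite !innerE trmx_mul map_mxM -mulmxA [_ *m (A *m y)]mulmxA.
by rewrite -[map_mx _ A^T *m A]/(adj_mx A * A) isoA mul1mx.
Qed.

Lemma innerBr x y z : inner x (y - z) = inner x y - inner x z.
Proof. by rewrite !innerE mulmxBr !mxE. Qed.

Lemma innerZ c x y : inner (c *: x) (c *: y) = c^* * c * inner x y.
Proof.
rewrite /inner mulr_sumr; apply: eq_bigr => i _.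
by rewrite !mxE rmorphM mulrACA.
Qed.

Lemma inner_eq0 x : inner x x = 0 -> x = 0.
Proof.
move=> x0; apply/colP => i; rewrite mxE; apply/eqP.
rewrite -mul_conjC_eq0 mulrC; apply/eqP; move: i isT.
by apply: psumr_eq0P x0 => i _; rewrite mulrC mul_conjC_ge0.
Qed.

End InnerProduct.

(** * Pauli operators up to phase as vectors of a symplectic space *)

Section PauliLabels.
Variables (R : realType) (D : nat) (V : finType).
Hypothesis Dprime : prime D.

Local Notation label := {ffun V -> 'F_D * 'F_D}.
Implicit Types x y z : label.
Local Notation N := #|{: {ffun V -> 'I_D}}|.
Let D_gt1 : (1 < D)%N := prime_gt1 Dprime.
Local Notation chi := (chi R).

Definition pauli_op x : op R D V := tensor (fun v => pau R (x v)).
Local Notation T := pauli_op.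

(** The exponent of the phase in [T x * T y], where the Z part of [x] passes the X part of [y].
    Antisymmetrized, it is the symplectic form. *)
Definition pairing x y : 'F_D := \sum_v (x v).2 * (y v).1.
Definition symp x y := pairing x y - pairing y x.

Lemma pairingDl x y z : pairing (x + y) z = pairing x z + pairing y z.
Proof.
by rewrite -big_split; apply: eq_bigr => v _; rewrite ffunE mulrDl.
Qed.

Lemma pairingDr x y z : pairing x (y + z) = pairing x y + pairing x z.
Proof.
by rewrite -big_split; apply: eq_bigr => v _; rewrite ffunE mulrDr.
Qed.

Lemma sympDl x y z : symp (x + y) z = symp x z + symp y z.
Proof. by rewrite /symp pairingDl pairingDr; ring. Qed.

Lemma symp_anti x y : symp x y = - symp y x.
Proof. by rewrite /symp opprB. Qed.

Lemma sympDr x y z : symp x (y + z) = symp x y + symp x z.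
Proof. by rewrite symp_anti sympDl opprD -!symp_anti. Qed.

Lemma symp0 x : symp x 0 = 0.
Proof. by have /eqP := sympDr x 0 0; rewrite addr0 -subr_eq subrr => /eqP. Qed.

Lemma sympN x y : symp x (- y) = - symp x y.
Proof. by apply/eqP; rewrite -addr_eq0 -sympDr addNr symp0. Qed.

Lemma card_states : N = (D ^ #|V|)%N.
Proof. by rewrite card_ffun card_ord. Qed.

Lemma states_gt0 : (0 < N)%N.
Proof. by rewrite card_states expn_gt0 (ltnW D_gt1). Qed.

Lemma pauli_op0 : T 0 = 1.
Proof.
by rewrite -[RHS]tensor1; apply: eq_tensor => v; rewrite ffunE pau0.
Qed.

Lemma pauli_opM x y : T x * T y = chi (pairing x y) *: T (x + y).
Proof.
rewrite /T tensorM chi_sum // -tensorZ; apply: eq_tensor => v.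
by rewrite pauM // ffunE.
Qed.

Lemma pauli_op_unit x : T x \in unitmx.
Proof.
have: T x * T (- x) = chi (pairing x (- x)) *: (1 : op R D V)
  by rewrite pauli_opM subrr pauli_op0.
move/(congr1 ( *:%R (chi (pairing x (- x)))^-1)).
rewrite scalerA mulVf ?chi_neq0 // scale1r -scale_mulmxr.
by case/mulmx1_unit.
Qed.

Lemma pauli_op_isometry x : adj_mx (T x) * T x = 1.
Proof.
rewrite /T adj_tensor tensorM -[RHS]tensor1; apply: eq_tensor => v.
exact: pau_isometry.
Qed.

Lemma pauli_opC x y : T x * T y = chi (symp x y) *: (T y * T x).
Proof.
by rewrite !pauli_opM scalerA -chiD // subrK addrC.
Qed.

Definition single v (a : 'F_D * 'F_D) : label :=
  [ffun w => if w == v then a else 0].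

Lemma pairing_single x v a : pairing x (single v a) = (x v).2 * a.1.
Proof.
rewrite /pairing (bigD1 v) //= ffunE eqxx big1 ?addr0 // => w /negPf wv.
by rewrite ffunE wv mulr0.
Qed.

Lemma pairing_singlel x v a : pairing (single v a) x = a.2 * (x v).1.
Proof.
rewrite /pairing (bigD1 v) //= ffunE eqxx big1 ?addr0 // => w /negPf wv.
by rewrite ffunE wv mul0r.
Qed.

Lemma symp_single x v a :
  symp x (single v a) = (x v).2 * a.1 - (x v).1 * a.2.
Proof. by rewrite /symp pairing_single pairing_singlel [a.2 * _]mulrC. Qed.

(** At a site where [x] is nonzero, a single X or a single Z detects it. *)
Lemma symp_nondegenerate x : x != 0 -> exists y, symp x y != 0.
Proof.
move=> x0; have [v xv] : exists v, x v != 0.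
  apply/existsP; apply: contraNT x0; rewrite negb_exists => /forallP eqv.
  by apply/eqP/ffunP => v; apply/eqP; rewrite ffunE -[_ == _]negbK; exact: eqv.
have [x1|x1] := eqVneq (x v).1 0.
  exists (single v (1, 0)); rewrite symp_single /= mulr0 mulr1 subr0.
  by apply: contraNneq xv => x2; apply/eqP; case: (x v) x1 x2 => ? ? /= -> ->.
by exists (single v (0, 1)); rewrite symp_single /= mulr0 mulr1 sub0r oppr_eq0.
Qed.

(** Conjugation by some [T y] multiplies [T x] by a phase other than 1, yet preserves the trace. *)
Lemma trace_pauli_op x : x != 0 -> \tr (T x) = 0.
Proof.
case/symp_nondegenerate => y xy.
have: \tr (T x * T y * invmx (T y)) =
    \tr (chi (symp x y) *: (T y * T x) * invmx (T y)).
  by rewrite pauli_opC.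
rewrite [X in \tr X = _](mulmxK (pauli_op_unit y)) scale_mulmxl mxtraceZ.
rewrite [X in _ = _ * X]mxtrace_mulC mulmxA mulVmx ?pauli_op_unit // mul1mx.
move/eqP; rewrite -subr_eq0 -[X in X - _]mul1r -mulrBl mulf_eq0 subr_eq0.
by rewrite eq_sym chi_eq1 // (negPf xy) => /eqP.
Qed.

(** For nonzero [x] the trace vanishes, so the scalar would be 0, against invertibility. *)
Lemma pauli_op_scalar x c : T x = c%:M -> x = 0.
Proof.
move=> Tx; apply/eqP; apply: contraT => /trace_pauli_op.
rewrite Tx mxtrace_scalar => /eqP; rewrite -mulr_natr mulf_eq0 pnatr_eq0.
rewrite (gtn_eqF states_gt0) orbF => /eqP c0.
have := pauli_op_unit x; rewrite Tx c0 unitmxE det_scalar expr0n.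
by rewrite (gtn_eqF states_gt0) unitr0.
Qed.

Lemma pauli_op_neq0 x : T x != 0.
Proof.
apply/eqP => Tx; have := @pauli_op_scalar x 0.
rewrite raddf0 => /(_ Tx) x0; move: Tx; rewrite x0 pauli_op0 => /matrixP.
move/(_ (Ordinal states_gt0) (Ordinal states_gt0)); rewrite !mxE eqxx.
by move/eqP; rewrite oner_eq0.
Qed.

End PauliLabels.
(** * Stabilizer groups and their labels *)

(** In the rank factorization A = C R, idempotency forces R C = 1, an identity matrix of size the
    rank, and tr (C R) = tr (R C). *)
Lemma trace_idempotent (F : fieldType) n (A : 'M[F]_n) :
  A *m A = A -> \tr A = (\rank A)%:R.
Proof.
move=> AA; suff RC : row_base A *m col_base A = 1%:M.
  by rewrite -[in LHS](mulmx_base A) mxtrace_mulC RC mxtrace1.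
apply: (row_full_inj (col_base_full A)).
apply: (row_free_inj (row_base_free A)) => /=.
by rewrite mulmx1 mulmxA -mulmxA !mulmx_base.
Qed.

Section StabilizerGroups.
Variables (R : realType) (D : nat) (V : finType).
Hypothesis Dprime : prime D.

Local Notation label := {ffun V -> 'F_D * 'F_D}.
Local Notation N := #|{: {ffun V -> 'I_D}}|.
Local Notation T := (@pauli_op R D V).
Local Notation w := (omega R D).
Implicit Types (x y z m : label) (S : set (op R D V)) (A P : op R D V).
Let D_gt1 : (1 < D)%N := prime_gt1 Dprime.

Definition has_label S x := exists c, S (c *: T x).

(** The nonzero code vector implies that the group is abelian and without nontrivial scalars, and it
    is what a possible outcome preserves. *)
Definition pauli_stabilizer S :=
  [/\ is_group S, forall A, S A -> exists c x, A = c *: T x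
    & exists2 psi, psi != 0 & codespace S psi].

Lemma label_mulrnD x : x *+ D = 0.
Proof.
have F0 (a : 'F_D) : a *+ D = 0 by rewrite -mulr_natr pchar_Fp_0 // mulr0.
apply/ffunP => v; rewrite ffunMnE ffunE [LHS]surjective_pairing.
by rewrite -[(_ *+ D).1]/(fst _) -[(_ *+ D).2]/(snd _) !raddfMn /= !F0.
Qed.

Lemma label_mulrn_pred x : x *+ D.-1 = - x.
Proof.
apply/eqP; rewrite -addr_eq0 -mulrSr -[0](label_mulrnD x); apply/eqP.
by congr (_ *+ _); rewrite prednK ?prime_gt0.
Qed.

Lemma pauli_op_scaleM c d x y :
  exists e, (c *: T x) * (d *: T y) = e *: T (x + y).
Proof.
exists (c * d * chi R (pairing x y)).
by rewrite scale_mulmxl scale_mulmxr pauli_opM // !scalerA.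
Qed.

Lemma pauli_op_stab_neq0 x c (psi : 'cV_N) :
  c *: T x *m psi = psi -> psi != 0 -> c != 0.
Proof.
by move=> cT; apply: contraNneq => c0; rewrite -cT c0 scale0r mul0mx.
Qed.

(* [invmx A] is [A] itself when [A] is singular. *)
Lemma is_group_fix (psi : 'cV[R[i]]_N) :
  is_group (fun A : op R D V => A *m psi = psi).
Proof.
split=> [|A B Apsi Bpsi|A Apsi]; first exact: mul1mx.
  by rewrite -[A * B]/(A *m B) -mulmxA Bpsi.
have [uA|nuA] := boolP (A \in unitmx); first by rewrite -[in LHS]Apsi mulKmx.
by rewrite invmx_out.
Qed.

Lemma invmx_scale_pauli_op c x : c != 0 ->
  exists2 d, d != 0 & invmx (c *: T x) = d *: T (- x).
Proof.
move=> c0; exists (c^-1 / chi R (pairing x (- x))).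
  by rewrite mulf_neq0 ?invr_eq0 // chi_neq0.
have cT_unit : c *: T x \in unitmx by rewrite unitmxZ ?unitfE // pauli_op_unit.
apply: (can_inj (mulKmx cT_unit)); rewrite mulmxV //.
have /= := pauli_opM R Dprime x (- x); rewrite subrr pauli_op0 // => TT.
rewrite -[RHS]/(_ * _) scale_mulmxl scale_mulmxr TT !scalerA.
set a := (X in X *: _); suff -> : a = 1 by rewrite scale1r.
by rewrite /a; field; rewrite c0 chi_neq0.
Qed.

(** Bounds a generated group from above by the operators whose label lies in [B]. *)
Lemma is_group_labels (B : label -> Prop) :
  B 0 -> (forall x y, B x -> B y -> B (x + y)) -> (forall x, B x -> B (- x)) ->
  is_group (fun A : op R D V => exists c x, [/\ c != 0, B x & A = c *: T x]).
Proof.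
move=> B0 BD BN; split.
- by exists 1, 0; split; rewrite ?oner_eq0 // scale1r pauli_op0.
- move=> _ _ [c [x [c0 Bx ->]]] [d [y [d0 By ->]]].
  exists (c * d * chi R (pairing x y)), (x + y); split; last first.
  + by rewrite scale_mulmxl scale_mulmxr pauli_opM // !scalerA.
  + exact: BD.
  + by rewrite !mulf_neq0 ?chi_neq0.
- move=> _ [c [x [c0 Bx ->]]]; have [d d0 ->] := invmx_scale_pauli_op x c0.
  by exists d, (- x); split=> //; exact: BN.
Qed.

Lemma pauli_op_commute c d x m : c != 0 -> d != 0 ->
  (c *: T x) * (d *: T m) = (d *: T m) * (c *: T x) <-> symp x m = 0.
Proof.
move=> c0 d0; rewrite !scale_mulmxl !scale_mulmxr !scalerA (mulrC d).
rewrite (pauli_opC R Dprime x m); split=> [|->]; last by rewrite chi0 scale1r.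
rewrite (pauli_opM R Dprime m x) => /eqP; rewrite !scalerA -subr_eq0 -scalerBl.
rewrite scaler_eq0 (negPf (pauli_op_neq0 R Dprime _)) orbF.
set a := chi R (symp x m); set b := chi R _.
rewrite (_ : _ - _ = c * d * b * (a - 1)); last by ring.
rewrite !mulf_eq0 (negPf c0) (negPf d0) (negPf (chi_neq0 R D_gt1 _)) /=.
by rewrite subr_eq0 chi_eq1 // => /eqP.
Qed.

(** Multiplication by [T (- y)] turns the right side into a scalar, so [x - y] is the label of a
    scalar. *)
Lemma pauli_op_inj c d x y : c != 0 -> c *: T x = d *: T y -> x = y.
Proof.
move=> c0 cTdT; apply/eqP; rewrite -subr_eq0; apply/eqP.
have /eqP := congr1 (fun A => A * T (- y)) cTdT.
rewrite !scale_mulmxl !pauli_opM // subrr pauli_op0 // !scalerA.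
set a := c * _; have a0 : a != 0 by rewrite mulf_neq0 // chi_neq0.
move/eqP/(congr1 ( *:%R a^-1)); rewrite scalerA mulVf // scale1r scalerA.
by rewrite scalemx1; exact: pauli_op_scalar.
Qed.

Section OneGroup.
Variable S : set (op R D V).
Hypothesis stabS : pauli_stabilizer S.

Lemma stab_scalar_neq0 c x : S (c *: T x) -> c != 0.
Proof.
by case: stabS => _ _ [psi psi0 codepsi] /codepsi /pauli_op_stab_neq0; apply.
Qed.

Lemma stab_scalar_inj c d x : S (c *: T x) -> S (d *: T x) -> c = d.
Proof.
case: stabS => _ _ [psi psi0 codepsi] /codepsi Sc /codepsi Sd.
move: Sc; rewrite -[in RHS]Sd -!scalemxAl => /eqP; rewrite -subr_eq0 -scalerBl.
rewrite scaler_eq0 subr_eq0 => /orP[/eqP//|/eqP T0].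
by move: Sd psi0; rewrite -scalemxAl T0 scaler0 => <-; rewrite eqxx.
Qed.

Lemma has_label0 : has_label S 0.
Proof.
by case: stabS => -[S1 _ _] _ _; exists 1; rewrite scale1r pauli_op0.
Qed.

Lemma has_labelD x y : has_label S x -> has_label S y -> has_label S (x + y).
Proof.
case: stabS => -[_ SM _] _ _ [c Sc] [d Sd].
have [e def_e] := pauli_op_scaleM c d x y.
by exists e; rewrite -def_e; exact: SM.
Qed.

Lemma has_labelN x : has_label S x -> has_label S (- x).
Proof.
case: stabS => -[_ _ SV] _ _ [c Sc].
have [d _ def_d] := invmx_scale_pauli_op x (stab_scalar_neq0 Sc).
by exists d; rewrite -def_d; exact: SV.
Qed.

Lemma has_labelMn x k : has_label S x -> has_label S (x *+ k).
Proof.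
move=> Sx; elim: k => [|k IHk]; first exact: has_label0.
by rewrite mulrS; exact: has_labelD.
Qed.

(** [T x] is an isometry and [c *: T x] fixes a nonzero vector, so c has modulus 1. *)
Lemma stab_scalar_unitary c x : S (c *: T x) -> c^* * c = 1.
Proof.
case: stabS => _ _ [psi psi0 codepsi] /codepsi Sc.
have := congr1 (fun phi => inner phi phi) Sc.
rewrite -scalemxAl innerZ inner_isometry ?pauli_op_isometry // => /eqP.
rewrite -subr_eq0 -[X in _ - X]mul1r -mulrBl mulf_eq0 subr_eq0.
case/orP => [/eqP//|/eqP/inner_eq0 psiE].
by rewrite psiE eqxx in psi0.
Qed.

Lemma stab_isometry A phi psi :
  S A -> inner (A *m phi) (A *m psi) = inner phi psi.
Proof.
case: stabS => _ SP _ SA; have [c [x defA]] := SP A SA.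
rewrite defA in SA *; rewrite -!scalemxAl innerZ (stab_scalar_unitary SA) mul1r.
by rewrite inner_isometry ?pauli_op_isometry.
Qed.

Lemma stab_unit A : S A -> A \in unitmx.
Proof.
case: stabS => _ SP _ SA; have [c [x defA]] := SP A SA.
rewrite defA in SA *; rewrite unitmxZ ?pauli_op_unit // unitfE.
exact: stab_scalar_neq0 SA.
Qed.

(* [A phi] is another orthogonal projection of [A psi = psi] on the same
   eigenspace. *)
Lemma stab_fix_projection A P (o : 'I_D) psi phi :
  S A -> A * P = P * A -> codespace S psi -> outcome_projection P o psi phi ->
  A *m phi = phi.
Proof.
move=> SA AP codepsi [Pphi ortho]; have uA := stab_unit SA.
have APm B : A *m (P *m B) = P *m (A *m B) :> 'cV_N.
  by rewrite !mulmxA -[A *m P]/(A * P) AP.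
have PA : P *m (A *m phi) = w ^+ o *: (A *m phi).
  by rewrite -APm Pphi -scalemxAr.
apply/eqP; rewrite -subr_eq0; apply/eqP; set d := A *m phi - phi.
have Pd : P *m d = w ^+ o *: d by rewrite mulmxBr PA Pphi scalerBr.
apply: inner_eq0.
(* Both terms vanish: the first by orthogonality, the second after writing [psi] as [A *m psi] and
   [d] as A applied to a vector that is still in the eigenspace. *)
have -> : inner d d = inner d (psi - phi) - inner d (psi - A *m phi).
  by rewrite -innerBr; congr inner; rewrite opprB addrC addrA subrK.
rewrite ortho // sub0r -[in psi - _](codepsi A SA) -mulmxBr.
rewrite -[d](mulKVmx uA) stab_isometry // ortho ?oppr0 //.
apply: (can_inj (mulKmx uA)).
by rewrite APm mulKVmx // Pd -scalemxAr mulKVmx.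
Qed.

End OneGroup.

(** The projected state [phi] is the new nonzero code vector: the retained elements fix it by
    [stab_fix_projection], and the measured operator with its phase by definition. It also makes the
    scalars nonzero, so that commuting can be read from labels. *)
Lemma update_pauli_stabilizer S P (o : 'I_D) d m :
  pauli_stabilizer S -> P = d *: T m -> possible_outcome S P o ->
  pauli_stabilizer (update S P o) /\
  forall x, has_label (update S P o) x <->
    exists k y, [/\ has_label S y, symp y m = 0 & x = y + m *+ k].
Proof.
move=> stabS defP [psi [phi [codepsi proj phi0]]].
have [Pphi _] := proj; have w0 : w ^+ o != 0 by rewrite expf_neq0 ?omega_neq0.
have d0 : d != 0.
  apply: contraNneq phi0 => d0; move/eqP: Pphi.
  by rewrite defP d0 scale0r mul0mx eq_sym scaler_eq0 (negPf w0).
set S' := update S P o.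
pose B x := exists k y, [/\ has_label S y, symp y m = 0 & x = y + m *+ k].
have [[S1 SM SV] SP _] := stabS.
have S'group : is_group S'.
  split; first by move=> G [[G1 _ _] _].
    move=> A1 A2 SA1 SA2 G GP; have [[_ GM _] _] := GP.
    by apply: GM; [exact: SA1|exact: SA2].
  by move=> A SA G GP; have [[_ _ GV] _] := GP; apply: GV; exact: SA.
have S'P : S' (w ^- o *: P) by move=> G [_]; apply; left.
have S'S A : S A -> A * P = P * A -> S' A.
  by move=> SA AP G [_]; apply; right.
have fixphi A : S' A -> A *m phi = phi.
  move=> S'A; apply: (S'A (fun A => A *m phi = phi)); split.
    exact: is_group_fix.
  move=> A' [->|[SA AP]].
    by rewrite -scalemxAl Pphi scalerA mulVf // scale1r.
  exact: (stab_fix_projection stabS SA AP codepsi proj).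
have S'B A : S' A -> exists c x, [/\ c != 0, B x & A = c *: T x].
  pose G := fun A : op R D V => exists c x, [/\ c != 0, B x & A = c *: T x].
  move=> S'A; apply: (S'A G); split.
    apply: is_group_labels.
    - exists 0%N, 0; rewrite symp_anti symp0 oppr0 addr0.
      by split=> //; exact: has_label0.
    - move=> _ _ [k [y [Sy ym ->]]] [l [z [Sz zm ->]]].
      exists (k + l)%N, (y + z); rewrite mulrnDr addrACA sympDl ym zm addr0.
      by split=> //; exact: has_labelD.
    - move=> _ [k [y [Sy ym ->]]].
      (* Multiples of [m] are taken by natural numbers, and [D.-1] stands for -1. *)
      exists (D.-1 * k)%N, (- y); split; first exact: has_labelN.
        by rewrite symp_anti sympN -symp_anti ym oppr0.
      by rewrite opprD mulnC mulrnA label_mulrn_pred.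
  move=> A' [->|[SA AP]].
    exists (w ^- o * d), m; rewrite mulf_neq0 ?invr_eq0 // defP scalerA.
    split=> //.
    exists 1%N, 0; rewrite symp_anti symp0 oppr0 add0r; split=> //.
    exact: has_label0.
  have [c [x defA]] := SP A' SA; rewrite defA in SA AP *.
  have c0 := stab_scalar_neq0 stabS SA.
  exists c, x; split=> //; exists 0%N, x; rewrite addr0; split=> //.
    by exists c.
  by move: AP; rewrite defP => /(pauli_op_commute _ _ c0 d0).
have S'stab : pauli_stabilizer S'.
  split=> //; last by exists phi.
  by move=> A /S'B[c [x [_ _ ->]]]; exists c, x.
split=> // x; split=> [[c S'x]|[k [y [[c Sy] ym ->]]]].
  have [e [y [e0 By]]] := S'B _ S'x; move/esym => /(pauli_op_inj e0) yx.
  by rewrite -yx.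
apply: has_labelD => //.
  exists c; apply: (S'S) => //; rewrite defP; apply/pauli_op_commute => //.
  exact: (stab_scalar_neq0 stabS Sy).
apply: has_labelMn => //; exists (w ^- o * d).
by rewrite -scalerA -defP.
Qed.

(** Induction over one round. The isotropic set [K] contains every measured label, so labels
    inferred early in the round survive the later measurements. *)
Lemma measure_seq_labels (K : label -> Prop) s S S' :
  K 0 -> (forall x y, K x -> K y -> K (x + y)) ->
  (forall x y, K x -> K y -> symp x y = 0) ->
  (forall P, P \in s -> exists d m, K m /\ P = d *: T m) ->
  pauli_stabilizer S -> measure_seq D S s S' ->
  [/\ pauli_stabilizer S',
    forall x, has_label S x -> (forall m, K m -> symp x m = 0) ->
      has_label S' x,
    forall d m, d *: T m \in s -> K m -> has_label S' m &
    forall x, has_label S' x -> exists y z,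
      [/\ has_label S y, K z, x = y + z &
        forall P, P \in s -> exists d m, P = d *: T m /\ K m /\ symp y m = 0]].
Proof.
move=> K0 KD Kiso; elim: s S => [|P s IHs] S Ks stabS /=.
  by move=> ->; split=> // x Sx; exists x, 0; rewrite addr0.
case=> o [possP meas].
have [d [m [Km defP]]] := Ks P (mem_head _ _).
have [stabS1 labS1] := update_pauli_stabilizer stabS defP possP.
have Ks' Q : Q \in s -> exists d m, K m /\ Q = d *: T m.
  by move=> sQ; apply: Ks; rewrite in_cons sQ orbT.
have KMn k : K (m *+ k) by elim: k => // k IHk; rewrite mulrS; exact: KD.
have [stabS' keep new old] := IHs _ Ks' stabS1 meas.
split=> //.
- move=> x Sx xK; apply: keep => //; apply/labS1.
  by exists 0%N, x; rewrite addr0; split=> //; exact: xK.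
- move=> e n; rewrite in_cons => /orP[/eqP defP' Kn|]; last exact: new.
  apply: keep => [|k Kk]; last exact: Kiso.
  have [_ labS1'] := update_pauli_stabilizer stabS (esym defP') possP.
  apply/labS1'; exists 1%N, 0; rewrite add0r symp_anti symp0 oppr0.
  by split=> //; exact: has_label0.
- move=> _ /old[y [z [/labS1[k [x [Sx xm ->]]] Kz -> ys]]].
  exists x, (m *+ k + z); rewrite addrA; split=> // [|Q]; first exact: KD.
  rewrite in_cons => /orP[/eqP->|sQ]; first by exists d, m.
  have [e [n [defQ [Kn yn]]]] := ys Q sQ.
  exists e, n; split=> //; split=> //.
  (* The multiple of [m] lies in [K], hence is orthogonal to [n]; only [x] contributes. *)
  by move: yn; rewrite sympDl (Kiso _ _ (KMn k) Kn) addr0.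
Qed.

(* Negatives are generated as well, since labels have finite order. *)
Definition additive_span (gen : label -> Prop) (z : label) :=
  forall Q : label -> Prop, Q 0 -> (forall x y, Q x -> Q y -> Q (x + y)) ->
    (forall m, gen m -> Q m) -> Q z.

(** Taking for [K] the span of the check labels, the order of the measurements and their outcomes
    disappear from the description. *)
Lemma measure_round_labels (gen : label -> Prop) (C S S' : set (op R D V)) :
  (forall P, C P <-> exists2 m, gen m & P = T m) ->
  (forall x y, gen x -> gen y -> symp x y = 0) ->
  pauli_stabilizer S -> measure_round D C S S' ->
  pauli_stabilizer S' /\
  forall x, has_label S' x <-> exists y z,
    [/\ has_label S y, additive_span gen z,
      forall m, gen m -> symp y m = 0 & x = y + z].
Proof.
move=> CP giso stabS [s [_ sC meas]].
have K0 : additive_span gen 0 by [].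
have KD x y : additive_span gen x -> additive_span gen y ->
    additive_span gen (x + y).
  by move=> Kx Ky Q Q0 QD Qg; apply: (QD x y); [exact: Kx|exact: Ky].
have orthK y : (forall m, gen m -> symp y m = 0) ->
    forall m, additive_span gen m -> symp y m = 0.
  move=> yg m Km; apply: (Km (fun m => symp y m = 0)) => //; first exact: symp0.
  by move=> m1 m2 y1 y2; rewrite sympDr y1 y2 addr0.
have Kiso x y : additive_span gen x -> additive_span gen y -> symp x y = 0.
  move=> Kx Ky; apply: (orthK x) Ky => m gm; rewrite symp_anti.
  by rewrite (orthK m) ?oppr0 // => n gn; exact: giso.
have Ks P : P \in s -> exists d m, additive_span gen m /\ P = d *: T m.
  move=> /sC/CP[m gm ->]; exists 1, m; rewrite scale1r; split=> //.
  by move=> Q _ _; apply.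
have [stabS' keep new old] := measure_seq_labels K0 KD Kiso Ks stabS meas.
split=> // x; split=> [/old[y [z [Sy Kz -> ys]]]|[y [z [Sy Kz yg ->]]]].
  exists y, z; split=> // m gm.
  have /ys[d [n [defT [_ yn]]]] : T m \in s by apply/sC/CP; exists m.
  rewrite (@pauli_op_inj 1 d m n) ?oner_eq0 //.
  by rewrite scale1r.
apply: has_labelD => //; first by apply: keep => // m; exact: orthK.
apply: Kz => [|x1 x2|m gm]; first exact: has_label0.
  exact: has_labelD.
apply: (new 1 m); last by move=> Q _ _; apply.
by rewrite scale1r; apply/sC/CP; exists m.
Qed.

Lemma encodes_of_labels S (B : {set label}) k :
  pauli_stabilizer S -> (forall x, x \in B <-> has_label S x) ->
  (#|B| * D ^ k)%N = (D ^ #|V|)%N -> encodes D S k.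
Proof.
move=> stabS BS cardB; have [[S1 SM SV] SP _] := stabS.
(* The unique scalar with which [x] occurs in [S]; the default 0 is taken only outside [B]. *)
pose c x := xget 0 [set c | S (c *: T x)].
have Sc x : x \in B -> S (c x *: T x).
  by move/BS => [a Sa]; apply: (@xgetPex _ 0 [set c | S (c *: T x)]); exists a.
have c0 : c 0 = 1.
  apply: (stab_scalar_inj stabS (Sc 0 _)); first by apply/BS; exact: has_label0.
  by rewrite pauli_op0 // scale1r.
have B_gt0 : (0 < #|B|)%N.
  by apply/card_gt0P; exists 0; apply/BS; exact: has_label0.
pose Pi : op R D V := #|B|%:R^-1 *: \sum_(x in B) c x *: T x.
have BPi y : y \in B -> (c y *: T y) *m Pi = Pi.
  move=> By; rewrite /Pi -scalemxAr mulmx_sumr; congr (_ *: _).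
  (* Translation by [y] permutes [B], and uniqueness of scalars matches the coefficients. *)
  rewrite [RHS](reindex_inj (addrI y)) /=; apply: eq_big => x.
    apply/idP/idP => Bx; last first.
      rewrite -[x](addKr y).
      by apply/BS/has_labelD => //; [apply: has_labelN => //|]; apply/BS.
    by apply/BS/has_labelD => //; apply/BS.
  move=> Bx; have [e def_e] := pauli_op_scaleM (c y) (c x) y x.
  rewrite -[LHS]/(_ * _) def_e; congr (_ *: _).
  apply: (@stab_scalar_inj S stabS _ _ (y + x)).
    by rewrite -def_e; apply: SM; exact: Sc.
  by apply/Sc/BS/has_labelD => //; apply/BS.
have B0 : #|B|%:R != 0 :> R[i] by rewrite pnatr_eq0 -lt0n.
have PiPi : Pi *m Pi = Pi.
  rewrite {1}/Pi -scalemxAl mulmx_suml (eq_bigr (fun=> Pi)) => [|x /BPi//].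
  by rewrite sumr_const -[X in _ *: X]scaler_nat scalerA mulVf ?scale1r.
have codePi (psi : 'cV_N) : codespace S psi <-> Pi *m psi = psi.
  split=> [codepsi|Pipsi A SA].
    rewrite /Pi -scalemxAl mulmx_suml.
    rewrite (eq_bigr (fun=> psi)) => [|x /Sc/codepsi//].
    by rewrite sumr_const -[X in _ *: X]scaler_nat scalerA mulVf ?scale1r.
  have [a [x defA]] := SP A SA; rewrite defA in SA *.
  have Bx : x \in B by apply/BS; exists a.
  by rewrite (stab_scalar_inj stabS SA (Sc x Bx)) -Pipsi mulmxA BPi.
have rankPi : (\rank Pi = D ^ k)%N.
  apply/eqP; rewrite -(eqr_nat R[i]) -trace_idempotent // mxtraceZ.
  (* Only label 0, whose scalar is 1, has nonzero trace. *)
  rewrite raddf_sum (bigD1 (0 : label)) /=; last by apply/BS; exact: has_label0.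
  rewrite big1 => [|x /andP[_ x0]]; last first.
    by rewrite mxtraceZ trace_pauli_op // mulr0.
  rewrite addr0 c0 scale1r pauli_op0 // mxtrace1 card_states -cardB natrM.
  by rewrite mulKf.
have cb := row_full_inj (col_base_full Pi).
(* The code space is realized as the image of [col_base Pi], which is injective, so its dimension is
   the rank. *)
pose f := linfun (mulmx (col_base Pi) : 'cV_(\rank Pi) -> 'cV_N).
have ker_f : lker f == 0%VS.
  by apply/lker0P => u v; rewrite !lfunE; exact: cb.
exists (limg f); split=> [psi|]; last first.
  rewrite limg_dim_eq.
    by rewrite dimvf -rankPi; exact: etrans (dim_matrix _ _ _) (muln1 _).
  by rewrite (eqP ker_f) capv0.
split=> [/memv_imgP[u _ ->]|/codePi Pipsi].
  apply/codePi; rewrite lfunE /= mulmxA; congr (_ *m _).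
  apply: (row_free_inj (row_base_free Pi)) => /=.
  by rewrite -mulmxA mulmx_base.
apply/memv_imgP; exists (row_base Pi *m psi); first exact: memvf.
by rewrite lfunE /= mulmxA mulmx_base.
Qed.

End StabilizerGroups.
(** * Labels of the instantaneous stabilizer groups *)

Definition next (c : color) : color :=
  match c with green => red | red => blue | blue => green end.

Lemma next3 c : next (next (next c)) = c. Proof. by case: c. Qed.

Lemma color_cases l c : [\/ c = l, c = next l | c = next (next l)].
Proof.
by case: l; case: c; (exact: Or31) || (exact: Or32) || (exact: Or33).
Qed.

Lemma next_neq c : next c <> c. Proof. by case: c. Qed.

Lemma next2_neq c : next (next c) <> c. Proof. by case: c. Qed.

(** Lets a color-indexed family be given by its values relative to the current color [l]. *)
Lemma color_fun (A : Type) l (y0 y1 y2 : A) :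
  exists y : color -> A,
    [/\ y l = y0, y (next l) = y1 & y (next (next l)) = y2].
Proof.
case: l.
- by exists (fun c => match c with green => y0 | red => y1 | blue => y2 end).
- by exists (fun c => match c with red => y0 | blue => y1 | green => y2 end).
- by exists (fun c => match c with blue => y0 | green => y1 | red => y2 end).
Qed.

Definition color_eqb (c c' : color) : bool :=
  match c, c' with
  | green, green | red, red | blue, blue => true
  | _, _ => false
  end.

Lemma color_eqP : Equality.axiom color_eqb.
Proof. by case; case; constructor. Qed.

HB.instance Definition _ := hasDecEq.Build color color_eqP.

Lemma card_fibers (T U : finType) (h : T -> U) (A : {set T}) k :
  (forall x, x \in A -> #|[set y in A | h y == h x]| = k) ->
  #|A| = (#|h @: A| * k)%N.
Proof.
move=> fib; rewrite -sum1_card (partition_big_imset h) /= -sum_nat_const.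
apply: eq_bigr => _ /imsetP[x Ax ->]; rewrite -(fib x Ax) -sum1_card.
by apply: eq_bigl => y; rewrite inE.
Qed.

(** * Evolution of the label set over the rounds *)

Section CheckLabels.
Variables (D : nat) (V : finType).
Hypothesis Dprime : prime D.
Local Notation F := 'F_D.
Local Notation label := {ffun V -> F * F}.
Variables (lab : color -> V -> F * F) (s : color -> V -> V).
Implicit Types (a b : V -> F) (x y z m : label) (c l : color) (v u : V).

(** The symplectic form of a single site. *)
Definition area (p q : F * F) : F := p.2 * q.1 - p.1 * q.2.

Hypothesis sK : forall c, involutive (s c).
Hypothesis s_neq : forall c v, s c v <> v.
Hypothesis lab_sum : forall v, lab green v + lab red v + lab blue v = 0.
Local Notation kappa v := (area (lab green v) (lab red v)).
Hypothesis kappa_neq0 : forall v, kappa v != 0.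
Hypothesis kappa_s : forall c v, kappa (s c v) = - kappa v.

Definition invariant c a := forall v, a (s c v) = a v.

(** A product of the color-[c] Paulis with a site-dependent exponent [a]; checks and plaquettes are
    both of this form. *)
Definition monomial a c : label :=
  [ffun v => (a v * (lab c v).1, a v * (lab c v).2)].

Definition check_label l v : label :=
  single v (lab l v) + single (s l v) (lab l (s l v)).

Lemma lab_next2 c v : lab (next (next c)) v = - lab c v - lab (next c) v.
Proof.
apply: (addrI (lab c v + lab (next c) v)); rewrite -opprD subrr.
case: c => /=; first exact: lab_sum.
  by rewrite addrC addrA lab_sum.
by rewrite -addrA addrC lab_sum.
Qed.

Lemma area_next c v : area (lab c v) (lab (next c) v) = kappa v.
Proof.
have := lab_next2 green v; rewrite /area; case: c => //= ->.
  by rewrite /=; ring.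
by rewrite /=; ring.
Qed.

Lemma area_next2 c v : area (lab c v) (lab (next (next c)) v) = - kappa v.
Proof. by rewrite lab_next2 -(area_next c) /area /=; ring. Qed.

Lemma symp_check x l v :
  symp x (check_label l v) =
  area (x v) (lab l v) + area (x (s l v)) (lab l (s l v)).
Proof. by rewrite /check_label sympDr !symp_single. Qed.

Lemma symp_monomial_check a l c v :
  symp (monomial a c) (check_label l v) =
  a v * area (lab c v) (lab l v) +
  a (s l v) * area (lab c (s l v)) (lab l (s l v)).
Proof. by rewrite symp_check !ffunE /area /=; ring. Qed.

Lemma monomialD a b c :
  monomial (fun v => a v + b v) c = monomial a c + monomial b c.
Proof. by apply/ffunP => v; rewrite !ffunE; congr pair; exact: mulrDl. Qed.

Lemma monomialN a c : monomial (fun v => - a v) c = - monomial a c.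
Proof. by apply/ffunP => v; rewrite !ffunE; congr pair; exact: mulNr. Qed.

Lemma monomial_color_sum a c :
  monomial a c = - monomial a (next c) - monomial a (next (next c)).
Proof.
apply/ffunP => v; rewrite !ffunE lab_next2.
by congr pair; rewrite /=; ring.
Qed.

Lemma check_label_monomial l v :
  check_label l v = monomial (fun u => ((u == v) || (u == s l v))%:R) l.
Proof.
apply/ffunP => u; rewrite !ffunE.
have [->|uv] := eqVneq u v.
  rewrite (introF eqP (nesym (@s_neq l v))) addr0 !mul1r.
  by case: (lab l v).
have [->|_] := eqVneq u (s l v); first by rewrite add0r !mul1r; case: (lab _ _).
by rewrite addr0 !mul0r.
Qed.

(** For the converse, induct on the size of the support of [a]: subtracting [a v] copies of the
    check at [v] clears both ends of that edge, since [a] agrees on them. *)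
Lemma check_span l z :
  additive_span (fun m => exists v, m = check_label l v) z <->
  exists2 a, invariant l a & z = monomial a l.
Proof.
split=> [span_z|[a inva ->]].
  apply: (span_z (fun z => exists2 a, invariant l a & z = monomial a l)).
  - exists (fun=> 0) => //; apply/ffunP => v; rewrite !ffunE.
    by congr pair; rewrite mul0r.
  - move=> _ _ [a inva ->] [b invb ->]; exists (fun v => a v + b v).
      by move=> v; rewrite inva invb.
    by rewrite monomialD.
  - move=> _ [v ->]; exists (fun u => ((u == v) || (u == s l v))%:R).
      move=> u; rewrite (inj_eq (inv_inj (sK l))).
      by rewrite (can2_eq (sK l) (sK l)) orbC.
    exact: check_label_monomial.
move=> Q Q0 QD Qg; have [k] := ubnP #|[set v | a v != 0]|.
elim: k => // k IHk in a inva *; rewrite ltnS => a_le.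
have [v av|a0] := pickP (fun v => a v != 0); last first.
  suff -> : monomial a l = 0 by [].
  apply/ffunP => v; rewrite !ffunE.
  by move/negbFE/eqP: (a0 v) => ->; congr pair; rewrite mul0r.
pose b u := a u - a v * ((u == v) || (u == s l v))%:R.
have -> : monomial a l = monomial b l + check_label l v *+ (a v).
  have nat_scale (r : F) : r *+ (a v) = a v * r by rewrite -mulr_natl natr_Zp.
  apply/ffunP => u; rewrite check_label_monomial !ffunE ffunMnE ffunE.
  rewrite [X in _ = _ + X]surjective_pairing.
  rewrite -[(_ *+ _).1]/(fst _) -[(_ *+ _).2]/(snd _) !raddfMn /= !nat_scale.
  by congr pair; rewrite /= /b; ring.
apply: (QD); last first.
  elim: (nat_of_ord (a v)) => [|n IHn]; first by rewrite mulr0n.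
  by rewrite mulrS; apply: QD => //; apply: Qg; exists v.
have invb : invariant l b.
  move=> u; rewrite /b inva (inj_eq (inv_inj (sK l))).
  by rewrite (can2_eq (sK l) (sK l)) orbC.
apply: IHk => //; apply: leq_trans a_le; apply/proper_card/properP; split.
  apply/fintype.subsetP => u; rewrite !inE /b.
  have [->|_] := eqVneq u v; first by rewrite av.
  have [->|_] := eqVneq u (s l v); first by rewrite inva av.
  by rewrite mulr0 subr0.
by exists v; rewrite !inE ?av // /b eqxx mulr1 subrr eqxx.
Qed.

(* The checks of color [l] generate the terms [a v * lab l v] with [a] constant
   on the edges of color [l].  Up to a phase, the plaquettes of color [c]
   multiply to [y c v * lab c v] with [y c] constant on their boundaries,
   because the labels of the other two colors sum to [- lab c v]. *)
Definition isg_label l x := exists a (y : color -> V -> F),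
  [/\ invariant l a, forall c c', c <> c' -> invariant c' (y c) &
      x = monomial (fun v => a v + y l v) l + monomial (y (next l)) (next l)
          + monomial (y (next (next l))) (next (next l))].

(** The effect of measuring all checks of color [l], in the form given by [measure_round_labels]. *)
Definition round_step (L L' : label -> Prop) l :=
  forall x, L' x <-> exists y z,
    [/\ L y, additive_span (fun m => exists v, m = check_label l v) z,
      forall m, (exists v, m = check_label l v) -> symp y m = 0 & x = y + z].

(** For equal colors the area of a label with itself is 0. Otherwise [a] agrees at the two ends of
    the edge while kappa changes sign, so the two contributions cancel. *)
Lemma plaquette_check c a l v : (forall c', c <> c' -> invariant c' a) ->
  symp (monomial a c) (check_label l v) = 0.
Proof.
move=> inva; rewrite symp_monomial_check.
have [->|->|defl] := color_cases c l.
- by rewrite /area; ring.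
- rewrite !area_next kappa_s inva; first by ring.
  by move/esym/next_neq.
- rewrite defl !area_next2 kappa_s inva; first by ring.
  by move/esym/next2_neq.
Qed.

(** Commutation reads (a v - a (s v)) kappa v = 0 with s the involution of color [next l], and kappa
    does not vanish. *)
Lemma check_orthogonal_invariant l a :
  (forall v, symp (monomial a l) (check_label (next l) v) = 0) ->
  invariant (next l) a.
Proof.
move=> orth v; have := orth v; rewrite symp_monomial_check !area_next kappa_s.
rewrite mulrN -mulrBl => /eqP; rewrite mulf_eq0 (negPf (kappa_neq0 v)) orbF.
by rewrite subr_eq0 => /eqP.
Qed.

(** Plaquette terms commute with every check, so the old check coefficient [a] must be invariant
    under the new color too. It then belongs to plaquettes of the third color, up to new checks. *)
Lemma round_step_upper (L L' : label -> Prop) l :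
  round_step L L' (next l) -> (forall x, L x -> isg_label l x) ->
  forall x, L' x -> isg_label (next l) x.
Proof.
move=> step Lub x /step[p [q [/Lub[a [y [inva invy ->]]]]]].
case/check_span => b invb -> orth ->.
have inva' : invariant (next l) a.
  apply: check_orthogonal_invariant => v.
  have := orth _ (ex_intro _ v erefl); rewrite monomialD !sympDl.
  rewrite (plaquette_check _ v (invy l)) (plaquette_check _ v (invy (next l))).
  by rewrite (plaquette_check _ v (invy (next (next l)))) !addr0.
(* As the three labels sum to zero, [a] times the label of color [l] is -a times each of the other
   two; one part joins the third color's plaquettes, the other the new checks. *)
have [y' [yl yl1 yl2]] := color_fun l (y l) (y (next l))
  (fun v => y (next (next l)) v - a v).
exists (fun v => b v - a v), y'; split.
- by move=> v; rewrite invb inva'.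
- move=> c c' cc'.
  have [defc|defc|defc] := color_cases l c; rewrite defc ?yl ?yl1 ?yl2.
  + by apply: invy; rewrite -defc.
  + by apply: invy; rewrite -defc.
  + move=> v; have [defc'|defc'|defc'] := color_cases l c'.
    * by rewrite defc' inva invy //; exact: next2_neq.
    * by rewrite defc' inva' invy //; exact: next_neq.
    * by case: cc'; rewrite defc defc'.
- rewrite next3 yl1 yl2 yl; apply/ffunP => v; rewrite !ffunE !lab_next2.
  by congr pair; rewrite /=; ring.
Qed.

Lemma round_step_span (L L' : label -> Prop) l :
  round_step L L' l -> L 0 -> forall a, invariant l a -> L' (monomial a l).
Proof.
move=> step L0 a inva; apply/step; exists 0, (monomial a l); split=> //.
- by apply/check_span; exists a.
- by move=> m _; rewrite symp_anti symp0 oppr0.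
- by rewrite add0r.
Qed.

Lemma round_step_keep (L L' : label -> Prop) l :
  round_step L L' l -> forall x, L x ->
  (forall v, symp x (check_label l v) = 0) -> L' x.
Proof.
move=> step x Lx orth; apply/step; exists x, 0; rewrite addr0; split=> //.
by move=> _ [v ->].
Qed.

(* The plaquette operator is, up to a phase, the product of the checks of the
   last two rounds around the plaquette. *)
Lemma round_step_plaquette (L L' : label -> Prop) l :
  round_step L L' (next l) -> L 0 -> (forall x y, L' x -> L' y -> L' (x + y)) ->
  (forall a, invariant l a -> L (monomial a l)) ->
  forall a, (forall c, next (next l) <> c -> invariant c a) ->
  L' (monomial a (next (next l))).
Proof.
move=> step L0 L'D LK a inva.
have invl : invariant l a by apply: inva; exact: next2_neq.
have invl1 : invariant (next l) a by apply: inva; exact: next_neq.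
have -> : monomial a (next (next l)) =
    monomial (fun v => - a v) l + monomial (fun v => - a v) (next l).
  rewrite [LHS]monomial_color_sum next3 !monomialN addrC.
  by [].
(* The second summand is measured in this round; the first comes from the previous round and
   commutes with the new checks. *)
apply: L'D; last first.
  by apply: (round_step_span step) => // v; rewrite invl1.
apply: (round_step_keep step); first by apply: LK => v; rewrite invl.
move=> v; rewrite symp_monomial_check !area_next kappa_s invl1; ring.
Qed.

(* [L t] is the situation before round [t]: [L 4] belongs to round 3, when the
   plaquettes of all three colors have been inferred. *)
Lemma isg_labels (L : nat -> label -> Prop) (k : nat -> color) :
  (forall t, L t 0) -> (forall t x y, L t x -> L t y -> L t (x + y)) ->
  (forall t, k t.+1 = next (k t)) ->
  (forall x, L 0%N x -> x = 0) ->
  (forall t, round_step (L t) (L t.+1) (k t.+1)) ->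
  forall t x, (3 < t)%N -> L t x <-> isg_label (k t) x.
Proof.
move=> L0 LD kS Linit step t x.
have upper (u : nat) : forall z, L u z -> isg_label (k u) z.
  elim: u => [z /Linit ->|u IHu]; last first.
    by rewrite kS; apply: round_step_upper IHu; rewrite -kS.
  exists (fun=> 0), (fun _ _ => 0); split=> //.
  by apply/ffunP => v; rewrite !ffunE /=; congr pair; rewrite /=; ring.
have span (u : nat) a : invariant (k u.+1) a -> L u.+1 (monomial a (k u.+1)).
  by move=> inva; exact: (round_step_span (step u)).
pose plaq (u : nat) c := forall a, (forall c', c <> c' -> invariant c' a) ->
  L u (monomial a c).
have plaq_keep (u : nat) c : plaq u c -> plaq u.+1 c.
  move=> plaqc a inva; apply: (round_step_keep (step u)); first exact: plaqc.
  by move=> v; exact: plaquette_check.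
have plaq_new (u : nat) : plaq u.+2 (next (next (k u.+1))).
  have step' : round_step (L u.+1) (L u.+2) (next (k u.+1)) by rewrite -kS.
  exact: (round_step_plaquette step' (L0 _) (LD _) (span u)).
move=> t_gt3; split; first exact: upper.
case: t t_gt3 => [|[|[|[|u]]]] // _ [a [y [inva invy ->]]].
(* The plaquettes of the three colors, in the order of the goals, are taken from times [u.+3],
   [u.+4] and [u.+2], and kept afterwards. *)
rewrite monomialD; apply: (LD); first apply: (LD); first apply: (LD).
- exact: span.
- have pl : plaq u.+4 (k u.+4).
    have -> : k u.+4 = next (next (k u.+2)) by rewrite -!kS.
    exact: plaq_keep (plaq_new u.+1).
  by apply: pl => c /invy.
- have pl : plaq u.+4 (next (k u.+4)).
    by have -> : next (k u.+4) = next (next (k u.+3)) by rewrite -!kS.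
  by apply: pl => c /invy.
- have pl : plaq u.+4 (next (next (k u.+4))).
    have -> : next (next (k u.+4)) = next (next (k u.+1)) by rewrite !kS next3.
    exact: plaq_keep (plaq_keep _ _ (plaq_new u)).
  by apply: pl => c /invy.
Qed.


(** * Counting labels by coefficients on the edges of color [l] and on all faces *)

Section Counting.
Variables (Ed Fc : finType) (e : V -> Ed) (f : color -> V -> Fc).
Variables (kind : Fc -> color) (v0 : V) (l : color).
Hypothesis e_s : forall v, e (s l v) = e v.
Hypothesis e_eq : forall v u, e v = e u -> v = u \/ v = s l u.
Hypothesis e_surj : forall E, exists v, e v = E.
Hypothesis kind_f : forall c v, kind (f c v) = c.
Hypothesis f_surj : forall G, exists v, f (kind G) v = G.
Hypothesis f_s : forall c c' v, c <> c' -> f c (s c' v) = f c v.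
Hypothesis f_eq : forall c v u a, f c v = f c u ->
  (forall c', c <> c' -> invariant c' a) -> a v = a u.
Hypothesis s_connected : forall a, (forall c, invariant c a) ->
  forall v u, a v = a u.

Local Notation params := ({ffun Ed -> F} * {ffun Fc -> F})%type.

(** [q.1] gives the exponents of the checks, [q.2] those of the plaquettes. *)
Definition label_of_params (q : params) : label :=
  monomial (fun v => q.1 (e v) + q.2 (f l v)) l
  + monomial (fun v => q.2 (f (next l) v)) (next l)
  + monomial (fun v => q.2 (f (next (next l)) v)) (next (next l)).

Lemma label_of_paramsB q q' :
  label_of_params (q - q') = label_of_params q - label_of_params q'.
Proof.
by apply/ffunP => v; rewrite !ffunE; congr pair; rewrite /=; ring.
Qed.

(** Invariant coefficients factor through edges and faces; their values are read off at chosen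
    representative vertices. *)
Lemma isg_label_params x :
  isg_label l x <-> exists q, x = label_of_params q.
Proof.
split=> [[a [y [inva invy ->]]]|[q ->]]; last first.
  exists (fun v => q.1 (e v)), (fun c v => q.2 (f c v)); split=> //.
    by move=> v; rewrite e_s.
  by move=> c c' cc' v; rewrite f_s.
have reP E : exists v, e v == E by have [v <-] := e_surj E; exists v.
have rfP G : exists v, f (kind G) v == G.
  by have [v <-] := f_surj G; exists v; rewrite kind_f.
pose re E := xchoose (reP E); pose rf G := xchoose (rfP G).
have aE v : a (re (e v)) = a v.
  by have /eqP/e_eq := xchooseP (reP (e v)); rewrite -/(re _) => -[->|->].
have yE c v : y c (rf (f c v)) = y c v.
  have /eqP := xchooseP (rfP (f c v)); rewrite -/(rf _) kind_f => fE.
  by apply: f_eq fE _ => c' /invy.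
exists ([ffun E => a (re E)], [ffun G => y (kind G) (rf G)]).
apply/ffunP => v; rewrite !ffunE /= !kind_f aE.
by rewrite !yE.
Qed.

(* Up to phases, the product of all plaquettes is trivial ([cd.1 = cd.2]) and
   that of the plaquettes of color [l] is a product of checks ([cd.1 = 0]). *)
Lemma label_of_params_eq0 q : label_of_params q = 0 <->
  exists cd : F * F, q = ([ffun=> cd.1 - cd.2],
    [ffun G => if kind G == l then cd.2 else cd.1]).
Proof.
have l1 : next l == l = false by apply/eqP/next_neq.
have l2 : next (next l) == l = false by apply/eqP/next2_neq.
split=> [q0|[[c d] ->]]; last first.
  apply/ffunP => v; rewrite !ffunE !kind_f eqxx l1 l2 lab_next2.
  by congr pair; rewrite /=; ring.
pose y c v := q.2 (f c v).
(* With the third label eliminated, the labels of colors [l] and [next l] are independent because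
   their area is nonzero; [E1] and [E2] are Cramer's rule. *)
have coef v : q.1 (e v) + y l v = y (next l) v /\
              y (next (next l)) v = y (next l) v.
  have eq1 := congr1 (fun x : label => (x v).1) q0.
  have eq2 := congr1 (fun x : label => (x v).2) q0.
  move: eq1 eq2; rewrite !ffunE lab_next2 /= -!/(y _ _).
  set a := q.1 _ + _; set b := y _ _; set c := y _ _ => eq1 eq2.
  have k0 := kappa_neq0 v; rewrite -(area_next l) in k0.
  have E1 : (b - c) * area (lab l v) (lab (next l) v) = 0.
    transitivity ((a * (lab l v).1 + b * (lab (next l) v).1 +
       c * (- (lab l v).1 - (lab (next l) v).1)) * (lab l v).2 +
       (a * (lab l v).2 + b * (lab (next l) v).2 +
       c * (- (lab l v).2 - (lab (next l) v).2)) * - (lab l v).1).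
      by rewrite /area; ring.
    by rewrite eq1 eq2; ring.
  have E2 : (a - c) * area (lab l v) (lab (next l) v) = 0.
    transitivity ((a * (lab l v).1 + b * (lab (next l) v).1 +
       c * (- (lab l v).1 - (lab (next l) v).1)) * - (lab (next l) v).2 +
       (a * (lab l v).2 + b * (lab (next l) v).2 +
       c * (- (lab l v).2 - (lab (next l) v).2)) * (lab (next l) v).1).
      by rewrite /area; ring.
    by rewrite eq1 eq2; ring.
  move/eqP: E1; rewrite mulf_eq0 (negPf k0) orbF subr_eq0 => /eqP bc.
  by move/eqP: E2; rewrite mulf_eq0 (negPf k0) orbF subr_eq0 bc => /eqP ->.
(* Each face coefficient is invariant under the colors other than its own. Equality with the
   coefficient of the third color supplies the missing invariance under [next l], and connectedness
   makes it constant. *)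
have y1 v u : y (next l) v = y (next l) u.
  apply: s_connected => c w; have [->|->|->] := color_cases l c.
  - by rewrite /y f_s //; exact: next_neq.
  - have [_ <-] := coef w; have [_ <-] := coef (s (next l) w).
    by rewrite /y f_s //; exact: next_neq.
  - by rewrite /y f_s //; apply/nesym/next_neq.
have yl v u : y l v = y l u.
  apply: s_connected => c w; have [->|->|->] := color_cases l c.
  (* Along an edge of color [l] the check exponent does not change, and its sum with [y l] is the
     constant [y (next l)]. *)
  - apply: (addrI (q.1 (e w))); have [-> _] := coef w.
    by rewrite -e_s; have [-> _] := coef (s l w); exact: y1.
  - by rewrite /y f_s //; apply/nesym/next_neq.
  - by rewrite /y f_s //; apply/nesym/next2_neq.
exists (y (next l) v0, y l v0); rewrite [LHS]surjective_pairing; congr pair.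
  apply/ffunP => E; rewrite ffunE /=; have [v <-] := e_surj E.
  have [eqv _] := coef v; rewrite (y1 v0 v) (yl v0 v) -eqv; ring.
apply/ffunP => G; rewrite ffunE /=; have [v <-] := f_surj G; rewrite kind_f.
have [->|->|->] := color_cases l (kind G).
- by rewrite eqxx; exact: yl.
- by rewrite l1; exact: y1.
- rewrite l2 (y1 v0 v); by have [_ <-] := coef v.
Qed.

(** Every fiber of [label_of_params] is a coset of its kernel. The kernel has D^2 elements, as faces
    of two colors at [v0] recover both constants. *)
Lemma card_isg_label (B : {set label}) :
  (forall x, x \in B <-> isg_label l x) ->
  (#|B| * D ^ 2)%N = (D ^ (#|Ed| + #|Fc|))%N.
Proof.
move=> defB; have cardF : #|{: F}| = D by rewrite card_Fp.
have -> : (D ^ (#|Ed| + #|Fc|) = #|[set: params]|)%N.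
  by rewrite cardsT card_prod !card_ffun cardF expnD.
pose ker (cd : F * F) : params := ([ffun=> cd.1 - cd.2],
    [ffun G => if kind G == l then cd.2 else cd.1]).
have ker_inj : injective ker.
  move=> [c d] [c' d'] [_ /ffunP eq_cd].
  have := eq_cd (f l v0); have := eq_cd (f (next l) v0); rewrite !ffunE !kind_f.
  by rewrite eqxx (introF eqP (@next_neq l)) => -> ->.
rewrite (@card_fibers _ _ label_of_params _ (D ^ 2)) => [|q _].
  congr (_ * _)%N; apply: eq_card => x; apply/idP/imsetP.
    by move/defB/isg_label_params => [q ->]; exists q.
  by move=> [q _ ->]; apply/defB/isg_label_params; exists q.
have <- : #|[set ker cd | cd in [set: F * F]]| = (D ^ 2)%N.
  by rewrite card_imset // cardsT card_prod cardF.
rewrite -[RHS](card_imset _ (addrI q)); apply: eq_card => q'; rewrite !inE /=.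
apply/eqP/imsetP => [eq_q|[_ /imsetP[cd _ ->] ->]].
  exists (q' - q); last by rewrite addrC subrK.
  have /label_of_params_eq0[cd ->] : label_of_params (q' - q) = 0.
    by rewrite label_of_paramsB eq_q subrr.
  exact: imset_f.
apply/eqP; rewrite -subr_eq0 -label_of_paramsB addrC addKr.
by apply/eqP/label_of_params_eq0; exists cd.
Qed.

End Counting.
End CheckLabels.
(** * Three-colored trivalent maps *)

Lemma third_color (a b c c' : color) :
  a <> b -> a <> c -> b <> c -> a <> c' -> b <> c' -> c = c'.
Proof. by case: a; case: b; case: c; case: c'. Qed.

Lemma third_color_or (a b c c' : color) :
  a <> b -> a <> c' -> b <> c' -> c <> c' -> c = a \/ c = b.
Proof. by case: a; case: b; case: c; case: c' => //; by [left|right]. Qed.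

Section ThreeColoredMap.
Variables (V : finType) (L : embedded_graph V) (col : {set V * V} -> color).
Hypothesis degree3 : forall v, #|[set u | adj L v u]| = 3%N.
Hypothesis coloring : three_coloring L col.
Implicit Types (v u w : V) (c : color).

Local Notation r := (Defs.rot L).
(** A corner at [v], that is, a face around [v], is named by the directed edge leaving [v] on its
    boundary. *)
Local Notation corner_color v u := (col (face L (v, u))).

Lemma rot_adj v u : adj L v u -> adj L v (r v u).
Proof.
by move=> vu; have := perm_closed u (rot_on L v); rewrite !inE => ->.
Qed.

Lemma rot_orbit v u : adj L v u ->
  [/\ r v (r v (r v u)) = u, r v u <> u, r v (r v u) <> u &
      forall w, adj L v w -> [\/ w = u, w = r v u | w = r v (r v u)]].
Proof.
move=> vu; have orbE : porbit (r v) u = [set w | adj L v w].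
  apply/setP => w; rewrite inE; apply/idP/idP => [|vw]; last exact: rot_cyclic.
  rewrite porbit_traject => /trajectP[i _ ->].
  by elim: i => //= i; exact: rot_adj.
have card3 : #|porbit (r v) u| = 3%N by rewrite orbE.
have := uniq_traject_porbit (r v) u; have := iter_porbit (r v) u.
have memE := porbit_traject (r v) u; rewrite card3 in memE *.
rewrite /= !inE negb_or => -> /and3P[/andP[n1 n2] _ _].
split=> //; try by apply/eqP; rewrite eq_sym.
move=> w vw; have : w \in porbit (r v) u by rewrite orbE inE.
rewrite memE /= !inE => /or3P[] /eqP ->; [exact: Or31|exact: Or32|exact: Or33].
Qed.

Lemma face_next_inj : injective (face_next L).
Proof. by move=> [x y] [x' y'] [-> /perm_inj ->]. Qed.

Lemma face_self d : d \in face L d.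
Proof. by rewrite inE connect0. Qed.

(** Hence the two faces beside the edge between [v] and [u] are the corners [u] and [r v u] at
    [v]. *)
Lemma face_nextE v u : face L (u, v) = face L (v, r v u).
Proof.
by apply/setP => d; rewrite !inE; exact: (same_fconnect1 face_next_inj).
Qed.

Lemma face_eq d d' : d' \in face L d -> face L d = face L d'.
Proof.
rewrite inE => dd'; apply/setP => d''; rewrite !inE.
by apply: same_connect => //; apply: fconnect_sym; exact: face_next_inj.
Qed.

Lemma face_adj d d' : adj L d.1 d.2 -> d' \in face L d -> adj L d'.1 d'.2.
Proof.
rewrite inE => d_adj /iter_findex <-; elim: (findex _ _ _) => //= i.
by move: (iter _ _ _) => [x y] /= xy; rewrite rot_adj // adj_sym.
Qed.

Lemma corner_color_rot v u :
  adj L v u -> corner_color v u <> corner_color v (r v u).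
Proof. by move=> /coloring; rewrite (face_nextE v u). Qed.

Lemma corner_color_rot2 v u : adj L v u ->
  corner_color v (r v (r v u)) <> corner_color v u /\
  corner_color v (r v (r v u)) <> corner_color v (r v u).
Proof.
move=> vu; have [r3 _ _ _] := rot_orbit vu; split.
  by rewrite -{2}r3; apply: corner_color_rot; do 2!apply: rot_adj.
by apply/nesym/corner_color_rot/rot_adj.
Qed.

Lemma corner_exists c v : exists u, adj L v u && (corner_color v u == c).
Proof.
have [u] : exists u, u \in [set u | adj L v u].
  by apply/card_gt0P; rewrite degree3.
rewrite inE => vu; have [n1 n2] := corner_color_rot2 vu.
have n3 := corner_color_rot vu.
have : [\/ corner_color v u = c, corner_color v (r v u) = c
         | corner_color v (r v (r v u)) = c].
  move: n1 n2 n3; case: c (corner_color v u) (corner_color v (r v u))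
    (corner_color v (r v (r v u))) => -[] [] [] //= *;
  by [exact: Or31|exact: Or32|exact: Or33].
case=> defc; [exists u|exists (r v u)|exists (r v (r v u))];
  by rewrite defc eqxx ?vu ?rot_adj.
Qed.

Definition corner c v := xchoose (corner_exists c v).

Lemma corner_adj c v : adj L v (corner c v).
Proof. by case/andP: (xchooseP (corner_exists c v)). Qed.

Lemma corner_colorE c v : corner_color v (corner c v) = c.
Proof. by case/andP: (xchooseP (corner_exists c v)) => _ /eqP. Qed.

Lemma cornerK v u : adj L v u -> corner (corner_color v u) v = u.
Proof.
move=> vu; have [r3 _ _ nbr] := rot_orbit vu.
have [n1 n2] := corner_color_rot2 vu; have n3 := corner_color_rot vu.
have := corner_colorE (corner_color v u) v.
by case: (nbr _ (corner_adj (corner_color v u) v)) => -> // /esym.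
Qed.

(* The corner of color [c] at [v] is opposite to the edge of color [c]. *)
Definition partner c v := r v (corner c v).

Lemma partner_adj c v : adj L v (partner c v).
Proof. by apply/rot_adj/corner_adj. Qed.

Lemma rot2_partner c v : r v (r v (partner c v)) = corner c v.
Proof. by have [] := rot_orbit (corner_adj c v). Qed.

Lemma partner_rot2 v u :
  adj L v u -> partner (corner_color v (r v (r v u))) v = u.
Proof.
move=> vu; rewrite /partner cornerK; first by have [] := rot_orbit vu.
by do 2!apply: rot_adj.
Qed.

Lemma partner_colors c v (u := partner c v) :
  [/\ corner_color v u <> c, corner_color u v <> c &
      corner_color v u <> corner_color u v].
Proof.
have vu := partner_adj c v; have [n1 n2] := corner_color_rot2 vu.
have defc : corner_color v (r v (r v u)) = c.
  by rewrite rot2_partner corner_colorE.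
rewrite defc in n1 n2; rewrite (face_nextE v u).
by split; [exact: nesym|exact: nesym|exact: corner_color_rot].
Qed.

(** The two faces beside the edge have the two colors other than [c], so the remaining corner at the
    far end has color [c] again. *)
Lemma partnerK c : involutive (partner c).
Proof.
move=> v; set u := partner c v; have [n1 n2 n3] := partner_colors c v.
have uv : adj L u v by rewrite adj_sym partner_adj.
have [m1 m2] := corner_color_rot2 uv; rewrite -(face_nextE u v) in m2.
rewrite -[RHS](partner_rot2 uv); congr (partner _ u).
exact: third_color n3 n1 n2 (nesym m2) (nesym m1).
Qed.

Lemma partner_neq c v : partner c v <> v.
Proof. by move=> eq_v; have := partner_adj c v; rewrite eq_v adj_irr. Qed.

Definition face_of c v := face L (v, corner c v).

(** An edge of color [c'] borders faces of both other colors, so its two ends share the face of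
    color [c]. *)
Lemma face_of_partner c c' v :
  c <> c' -> face_of c (partner c' v) = face_of c v.
Proof.
move=> cc'; set u := partner c' v; have [n1 n2 n3] := partner_colors c' v.
have vu := partner_adj c' v; have uv : adj L u v by rewrite adj_sym.
have [defc|defc] : c = corner_color v u \/ c = corner_color u v.
  exact: third_color_or n3 n1 n2 cc'.
- rewrite /face_of defc [in RHS]cornerK // [in LHS](face_nextE u v) cornerK.
    by rewrite -face_nextE.
  exact: rot_adj.
- rewrite /face_of defc [in LHS]cornerK // [in RHS](face_nextE v u) cornerK.
    by rewrite -face_nextE.
  exact: rot_adj.
Qed.

Lemma edge_colorP c v u : edge_color L col c v u <-> u = partner c v.
Proof.
split=> [[vu colE]|->].
  have [n1 n2] := corner_color_rot2 vu.
  rewrite -[LHS](partner_rot2 vu); congr (partner _ v); apply: colE.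
  - by apply/imsetP; exists (v, r v (r v u)); rewrite // inE /= !rot_adj.
  - by left; exists (r v (r v u)); exact: face_self.
  - case=> /face_eq eqf; first by case: n1; rewrite eqf.
    by case: n2; rewrite eqf face_nextE.
(* Of the three faces around an end of the edge, two contain the edge; the third is the opposite
   corner. *)
have third w w' d : w' = partner c w -> d \in [set d | adj L d.1 d.2] ->
    face_at (face L d) w -> ~ face_has_edge (face L d) w w' ->
    col (face L d) = c.
  move=> defw' d_adj [x wx] noedge; have eqf := face_eq wx.
  have [_ _ _ nbr] := rot_orbit (partner_adj c w); rewrite eqf.
  have d_adj' : adj L d.1 d.2 by rewrite inE in d_adj.
  case: (nbr x (face_adj d_adj' wx)) => defx.
  - by case: noedge; left; rewrite defw' -defx.
  - by case: noedge; right; rewrite eqf defx -face_nextE defw' face_self.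
  - by rewrite defx rot2_partner corner_colorE.
split; first exact: partner_adj.
move=> _ /imsetP[d d_adj ->] [vf|uf] noedge; first exact: (third v).
apply: (third (partner c v) v) => //; first by rewrite partnerK.
by case=> ?; apply: noedge; [right|left].
Qed.

Lemma face_of_surj G : G \in faces L -> exists v, face_of (col G) v = G.
Proof.
case/imsetP => -[v u]; rewrite inE /= => vu ->; exists v.
by rewrite /face_of cornerK.
Qed.

Lemma face_ofP c v : face_of c v \in faces L.
Proof. by apply: imset_f; rewrite inE; exact: corner_adj. Qed.

Lemma face_of_color c v : col (face_of c v) = c.
Proof. exact: corner_colorE. Qed.

Lemma adj_partner v u : adj L v u ->
  exists2 c, c <> corner_color v u & u = partner c v.
Proof.
move=> vu; exists (corner_color v (r v (r v u))); last by rewrite partner_rot2.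
by have [] := corner_color_rot2 vu.
Qed.

(** Walk along the boundary of the face: a boundary edge of a face of color [c] never has color [c],
    so [a] is preserved at each step. *)
Lemma face_of_connected (A : Type) (a : V -> A) c v u :
  face_of c v = face_of c u ->
  (forall c', c <> c' -> forall w, a (partner c' w) = a w) -> a v = a u.
Proof.
move=> eqf inva; have : (u, corner c u) \in face_of c v.
  by rewrite eqf face_self.
rewrite inE => /iter_findex; set k := findex _ _ _; move: k => k defu.
suff [eqa _] : a (iter k (face_next L) (v, corner c v)).1 = a v /\
    iter k (face_next L) (v, corner c v) \in face_of c v.
  by rewrite -eqa defu.
elim: k {defu} => [|k [IHa IHf]] /=; first by rewrite face_self.
have IHadj := face_adj (corner_adj c v : adj L (v, _).1 _) IHf.
have colk := face_eq IHf; move: IHa IHf IHadj colk.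
move: (iter _ _ _) => [x y] /= IHa IHf xy colk.
have [c' c'_neq defy] := adj_partner xy.
rewrite -colk corner_colorE in c'_neq.
split; first by rewrite defy inva //; exact: nesym.
move: IHf; rewrite !inE => IHf; apply: connect_trans IHf _; exact: fconnect1.
Qed.

Lemma partner_connected (A : Type) (a : V -> A) :
  (forall c v, a (partner c v) = a v) -> forall v u, a v = a u.
Proof.
move=> inva v u; have /connectP[q] := adj_connected L v u.
elim: q v => [|w q IHq] v /=; first by move=> _ ->.
case/andP => vw /IHq{}IHq /IHq <-.
by have [c _ ->] := adj_partner vw.
Qed.

Definition color_edges c : {set {set V}} :=
  [set [set v; partner c v] | v in [set: V]].

Lemma mem_color_edges c v : [set v; partner c v] \in color_edges c.
Proof. exact: imset_f. Qed.

Lemma set2_eq (v u x y : V) : [set v; u] = [set x; y] ->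
  (v = x /\ u = y) \/ (v = y /\ u = x).
Proof.
move=> eq2; have : v \in [set x; y] by rewrite -eq2 set21.
have : u \in [set x; y] by rewrite -eq2 set22.
have : x \in [set v; u] by rewrite eq2 set21.
have : y \in [set v; u] by rewrite eq2 set22.
rewrite !inE => /orP[]/eqP ? /orP[]/eqP ? /orP[]/eqP ? /orP[]/eqP ?; subst;
  tauto.
Qed.

Lemma card_color_edges c : #|V| = (#|color_edges c| * 2)%N.
Proof.
rewrite -cardsT /color_edges.
apply: card_fibers => v _; have -> : [set u in [set: V] |
      [set u; partner c u] == [set v; partner c v]] = [set v; partner c v].
    apply/setP => u; rewrite !inE; apply/eqP/orP => [/set2_eq[[-> _]|[-> _]]|].
    - by left.
    - by right.
    by case=> /eqP -> //; rewrite partnerK finset.setUC.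
  by rewrite cards2 eq_sym (introF eqP (@partner_neq c v)).
Qed.

(** Double counting of directed edges: two per edge, three per vertex. *)
Lemma card_edges : (#|edges L| * 2)%N = (#|V| * 3)%N.
Proof.
pose A := [set d : V * V | adj L d.1 d.2].
have <- : #|A| = (#|edges L| * 2)%N.
  apply: card_fibers => -[v u]; rewrite inE /= => vu.
  have -> : [set d in A | [set d.1; d.2] == [set v; u]] = [set (v, u); (u, v)].
    apply/setP => -[x y]; rewrite !inE /= !xpair_eqE; apply/andP/orP.
      by case=> _ /eqP/set2_eq[[-> ->]|[-> ->]]; [left|right]; rewrite !eqxx.
    case=> /andP[/eqP -> /eqP ->]; rewrite ?vu //.
    by rewrite adj_sym vu finset.setUC.
  rewrite cards2 xpair_eqE; case: (v =P u) vu => [->|//].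
  by rewrite adj_irr.
have -> : #|V| = #|fst @: A|.
  rewrite -cardsT; apply: eq_card => v; rewrite inE; apply/esym/imsetP.
  by exists (v, partner green v) => //; rewrite inE partner_adj.
apply: card_fibers => -[v u]; rewrite inE /= => vu; rewrite -(degree3 v).
rewrite -(card_imset [set u | adj L v u] (_ : injective (pair v))); last first.
  by move=> x y [].
apply: eq_card => -[x y]; rewrite !inE /=; apply/andP/imsetP.
  by case=> xy /eqP defx; exists y; rewrite ?inE -?defx.
by case=> w; rewrite inE => vw [-> ->].
Qed.

End ThreeColoredMap.
(** * Instantaneous stabilizer groups of the code *)

Section PauliChecks.
Variables (R : realType) (D : nat) (V : finType).
Hypothesis Dprime : prime D.
Implicit Types (v u : V) (p q : 'F_D * 'F_D).
Local Notation T := (@pauli_op R D V).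

Definition residues (x : 'I_D * 'I_D) : 'F_D * 'F_D := (x.1%:R, x.2%:R).

Lemma comm_area x y : comm x y = area (residues x) (residues y).
Proof. by rewrite /comm /area addrC. Qed.

Lemma on_siteM v (A B : 'M[R[i]]_D) :
  on_site v (A * B) = on_site v A * on_site v B.
Proof.
rewrite tensorM; apply: eq_tensor => w.
by case: eqP; rewrite ?mulr1.
Qed.

Lemma on_site_pauli v x : on_site v (pauli R x) = T (single v (residues x)).
Proof.
apply: eq_tensor => w; rewrite ffunE; case: eqP => _; last by rewrite pau0.
by rewrite /pauli -pau_nat ?prime_gt1.
Qed.

Lemma on_site_pauliM v u x y : v != u ->
  on_site v (pauli R x) * on_site u (pauli R y) =
  T (single v (residues x) + single u (residues y)).
Proof.
move=> vu; rewrite !on_site_pauli pauli_opM // pairing_single ffunE.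
by rewrite eq_sym (negPf vu) mul0r chi0 scale1r.
Qed.

Lemma trivial_product_sum v u x1 x2 x3 y1 y2 y3 : v != u ->
  on_site v (pauli R x1 * pauli R x2 * pauli R x3) *
    on_site u (pauli R y1 * pauli R y2 * pauli R y3) = 1 ->
  residues x1 + residues x2 + residues x3 = 0.
Proof.
move=> vu; rewrite (on_siteM v (_ * _) (pauli R x3)) (on_siteM v (pauli R x1)).
rewrite (on_siteM u (_ * _) (pauli R y3)) (on_siteM u (pauli R y1)).
rewrite !on_site_pauli !(scale_mulmxl, scale_mulmxr, pauli_opM R Dprime).
rewrite !scalerA.
set a := (X in X *: _ = _) => aT.
have T0 : 1 *: T 0 = 1 by rewrite scale1r pauli_op0.
have sum0 := pauli_op_inj Dprime (oner_neq0 _) (etrans T0 (esym aT)).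
have := congr1 (fun x : {ffun V -> 'F_D * 'F_D} => x v) sum0.
by rewrite !ffunE eqxx (negPf vu) !addr0 => <-.
Qed.

End PauliChecks.

Lemma round_colorS t : round_color t.+1 = next (round_color t).
Proof.
rewrite /round_color -addn1 -modnDml.
by have := ltn_pmod t (isT : 0 < 3)%N; case: (t %% 3)%N => [|[|[|]]].
Qed.

Theorem theorem2 (R : realType) (D : nat) (V : finType) (L : embedded_graph V)
    (p g : nat) (col : {set V * V} -> color)
    (lab : color -> V -> 'I_D * 'I_D) :
  prime D ->
  p3_lattice L p ->
  has_genus L g ->
  (g = 1%N /\ p = 6%N) \/ [/\ (2 <= g)%N, (8 <= p)%N & ~~ odd p] ->
  three_coloring L col ->
  (D = 2%N -> forall l M, checks (R := R) L col lab l M -> M ^+ D = 1) ->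
  (forall v u, edge_color L col green v u ->
     comm (lab green v) (lab blue v) = - comm (lab green u) (lab blue u)) ->
  (forall v u, edge_color L col red v u ->
     comm (lab red v) (lab green v) = - comm (lab red u) (lab green u)) ->
  (forall v u, edge_color L col blue v u ->
     comm (lab blue v) (lab red v) = - comm (lab blue u) (lab red u)) ->
  (forall v, [/\ comm (lab green v) (lab red v) != 0,
                 comm (lab red v) (lab blue v) != 0
               & comm (lab blue v) (lab green v) != 0]) ->
  (forall v u, adj L v u ->
     on_site v (pauli R (lab green v) * pauli R (lab red v) *
                pauli R (lab blue v)) *
     on_site u (pauli R (lab green u) * pauli R (lab red u) *
                pauli R (lab blue u)) = 1) ->
  floquet_encodes D (checks (R := R) L col lab) (2 * g).
Proof.
move=> Dprime [_ degree3] genus _ coloring _ hg hr hb hne h3.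
pose s := partner degree3 coloring.
pose lb c v := residues (lab c v).
have adj_neq v u : adj L v u -> v != u.
  by move=> vu; apply: contraTneq vu => ->; rewrite adj_irr.
have sK c : involutive (s c) by exact: partnerK.
have s_neq c v : s c v <> v by exact: partner_neq.
have lab_sum v : lb green v + lb red v + lb blue v = 0.
  have vu := partner_adj degree3 coloring green v.
  exact: (trivial_product_sum Dprime (adj_neq _ _ vu) (h3 v _ vu)).
have kappa_neq0 v : area (lb green v) (lb red v) != 0.
  by have [+ _ _] := hne v; rewrite comm_area.
have kappa_s c v :
    area (lb green (s c v)) (lb red (s c v)) = - area (lb green v) (lb red v).
  have edge : edge_color L col c v (s c v) by apply/edge_colorP.
  (* Condition 1 pairs each color [c] with [next (next c)], whose area is minus kappa. *)
  apply: oppr_inj.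
  rewrite -(area_next2 lab_sum c (s c v)) -(area_next2 lab_sum c v).
  by case: c edge => [/hg|/hr|/hb]; rewrite !comm_area => ->; rewrite opprK.
pose gen l m := exists v, m = @check_label D V lb s l v.
have checksE l P : checks (R := R) L col lab l P <->
    exists2 m, gen l m & P = pauli_op R m.
  have checkE v : check R lab l v (s l v) = pauli_op R (check_label lb s l v).
    by apply: on_site_pauliM => //; apply/adj_neq/partner_adj.
  split=> [[v [u [/(edge_colorP degree3 coloring) -> ->]]]|[_ [v ->] ->]].
    by exists (check_label lb s l v); [exists v|exact: checkE].
  by exists v, (s l v); split; [apply/edge_colorP|rewrite -checkE].
have gen_iso l x y : gen l x -> gen l y -> symp x y = 0.
  (* Checks of one color carry the same label at a common site, and its area with itself is 0. *)
  move=> [v ->] [u ->]; rewrite check_label_monomial // symp_monomial_check.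
  by rewrite /area; ring.
(* Below, [S'] puts the trivial group at index 0, so round [t] has index [t.+1], beyond 3 as
   [isg_labels] requires; [k 0] is blue so that green follows. *)
exists 3%N => S [init step] t t_ge3.
pose S' t := if t is t'.+1 then S t' else (fun A : op R D V => A = 1).
pose k t := if t is t'.+1 then round_color t' else blue.
have kS t' : k t'.+1 = next (k t') by case: t' => //= t'; exact: round_colorS.
have stepS t' :
  measure_round D (checks (R := R) L col lab (k t'.+1)) (S' t') (S' t'.+1).
  by case: t'.
have stab0 : pauli_stabilizer (S' 0%N).
  split.
  - by split=> [|_ _ -> ->|_ ->]; rewrite ?mulr1 ?invmx1.
  - by move=> _ ->; exists 1, 0; rewrite scale1r pauli_op0.
  - exists (const_mx 1); last by move=> _ ->; rewrite mul1mx.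
    apply/eqP => /colP/(_ (Ordinal (states_gt0 V Dprime)))/eqP.
    by rewrite !mxE oner_eq0.
have stabS t' : pauli_stabilizer (S' t').
  elim: t' => // t' IHt.
  by have [] := measure_round_labels Dprime (checksE _) (@gen_iso _) IHt
    (stepS t').
have labelsS := isg_labels sK s_neq lab_sum kappa_neq0 kappa_s
  (L := fun t' => has_label (S' t')) (k := k).
have {}labelsS x : has_label (S' t.+1) x <-> isg_label lb s (k t.+1) x.
  apply: labelsS => //.
  - by move=> t'; exact: has_label0.
  - by move=> t' y z; exact: has_labelD.
  - move=> y [c cy]; apply/esym/(@pauli_op_inj R D V Dprime 1 c).
      exact: oner_neq0.
    by rewrite scale1r pauli_op0 // cy.
  - move=> t'.
    by have [_] := measure_round_labels Dprime (checksE _) (@gen_iso _)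
      (stabS t') (stepS t').
move: (k t.+1) labelsS => l labelsS.
pose B := [set x | `[< isg_label lb s l x >]].
have BE x : x \in B <-> isg_label lb s l x by rewrite inE; split=> /asboolP.
apply: (@encodes_of_labels R D V Dprime (S t) B) => [|x|].
- exact: (stabS t.+1).
- by rewrite BE -labelsS.
pose e v : {E | E \in color_edges degree3 coloring l} :=
  exist _ [set v; s l v] (mem_color_edges degree3 coloring l v).
pose f c v : {G | G \in faces L} :=
  exist _ (face_of degree3 coloring c v) (face_ofP degree3 coloring c v).
have [v0 _] := card_gt0P (adj_nonempty L).
have cardB : (#|B| * D ^ 2 =
    D ^ (#|{: {E | E \in color_edges degree3 coloring l}}| +
         #|{: {G | G \in faces L}}|))%N.
  apply: (card_isg_label Dprime lab_sum kappa_neq0 v0 (l := l) (s := s) (e := e)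
    (f := f) (kind := fun G => col (val G))) => //.
  - by move=> v; apply: val_inj; rewrite /= sK finset.setUC.
  - move=> v u [/set2_eq[[-> _]|[-> _]]]; [by left|by right].
  - case=> E EP; have /imsetP[v _ defE] := EP.
    by exists v; apply: val_inj; rewrite /= defE.
  - by move=> c v; exact: face_of_color.
  - move=> [G GP]; have [v defG] := face_of_surj degree3 coloring GP.
    by exists v; apply: val_inj.
  - by move=> c c' v cc'; apply: val_inj; exact: face_of_partner.
  - move=> c v u a /(congr1 val) /= eqf inva.
    exact: face_of_connected eqf inva.
  - by move=> a inva; exact: partner_connected inva.
rewrite !card_sig in cardB.
have := card_color_edges degree3 coloring l.
have := card_edges degree3 coloring.
move: genus; rewrite /has_genus => genus edges_card color_edges_card.
(* Euler's formula with |V| = 2 |E_l| and 2 |E| = 3 |V|. *)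
have sizes : (#|V| + 2 =
    #|color_edges degree3 coloring l| + #|faces L| + 2 * g)%N by lia.
apply/eqP; rewrite -(eqn_pmul2r (_ : 0 < D ^ 2)%N) ?expn_gt0 ?prime_gt0 //.
by rewrite -expnD sizes mulnAC cardB -expnD.
Qed.
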